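(* Let $M$ be a positive integer, let $u$ be the solution of the Poisson interface problem $$-\nabla^2u=f\ \text{in }\Omega\setminus\Gamma,\qquad u=g_0\ \text{on }\partial\Omega,\qquad [u]=g_1\ \text{on }\Gamma,\qquad [\nabla u\cdot\vec n]=g\ \text{on }\Gamma,$$ and let $(x^*,y^* )\in\Gamma$ be a point near which $\Gamma$ is parameterized by $$x=r(t)+x^*,\quad y=s(t)+y^*,\quad (r'(t))^2+(s'(t))^2>0,\qquad t\in(-\epsilon,\epsilon),\ \epsilon>0,$$ with $r,s$ smooth and $r(0)=s(0)=0$. Then for all $(m',n')\in\Lambda_{M+1}^1$, $$u_-^{(m',n')}=u_+^{(m',n')}+\sum_{(m,n)\in\Lambda_{M-1}}\left(T^+_{m',n',m,n}f_+^{(m,n)}+T^-_{m',n',m,n}f_-^{(m,n)}\right)+\sum_{(m,n)\in\Lambda_{M+1}}T^{g_1}_{m',n',m,n}\,g_1^{(m,n)}+\sum_{(m,n)\in\Lambda_M}T^{g}_{m',n',m,n}\,g^{(m,n)},$$ where all the transmission coefficients $T^{\pm},T^{g_1},T^{g}$ are uniquely determined by $r^{(k)}(0)$ and $s^{(k)}(0)$, $k=0,\ldots,M+1$ (together with the sign $\sigma$ recording the orientation of the parameterization relative to $\vec n$), and can be obtained by recursively calculating $U^{(m',n')}:=u_+^{(m',n')}-u_-^{(m',n')}$, $(m',n')\in\Lambda_{M+1}^1$, through $$U^{(0,0)}=g_1^{(0,0)}$$ and, for $p=1,\ldots,M+1$, $$\begin{bmatrix}U^{(0,p)}\\ U^{(1,p-1)}\end{bmatrix}=Q_p\begin{bmatrix}F_p\\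 G_{p-1}\end{bmatrix}-\sum_{n=1}^{p-1}Q_p\begin{bmatrix}U^{(0,n)}g_{0,n,p}+U^{(1,n-1)}g_{1,n-1,p}\\ U^{(0,n)}\tilde g_{0,n,p-1}+U^{(1,n-1)}\tilde g_{1,n-1,p-1}\end{bmatrix},$$ with $Q_p,F_p,G_{p-1},g_{m,n,p},\tilde g_{m,n,p}$ as defined in the context.
   Context: Setting. $\Omega=(l_1,l_2)\times(l_3,l_4)\subset\mathbb{R}^2$ is an open rectangle; $\psi$ is a smooth function of two variables; $\Gamma=\{(x,y)\in\Omega:\psi(x,y)=0\}$ is a smooth curve splitting $\Omega$ into $\Omega^+=\{\psi>0\}$ and $\Omega^-=\{\psi<0\}$, one lying on each side of $\Gamma$; $\vec n$ is the unit normal of $\Gamma$ pointing from $\Omega^-$ towards $\Omega^+$. For $(x_0,y_0)\in\Gamma$, $[u](x_0,y_0)$ is the limit of $u$ at $(x_0,y_0)$ from $\Omega^+$ minus its limit from $\Omega^-$, and $[\nabla u\cdot\vec n](x_0,y_0)$ is the limit of $\nabla u\cdot\vec n$ from $\Omega^+$ minus its limit from $\Omega^-$, where $\vec n=\vec n(x_0,y_0)$. Assumptions. $g_0,g_1,g$ are smooth ($g_1,g$ as functions of two variables near $(x^*,y^* )$). The restrictions $u_\pm,f_\pm$ of $u,f$ to $\Omega^\pm$ extend to smooth functions in a neighborhood of $(x^*,y^* )$, still denoted $u_\pm,f_\pm$. For $w\in\{u_\pm,f_\pm,g,g_1\}$ write $w^{(m,n)}=\frac{\partial^{m+n}w}{\partial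 x^m\partial y^n}(x^*,y^* )$. Index sets. $\mathbb{N}_0=\{0,1,2,\dots\}$, $\Lambda_K=\{(m,n)\in\mathbb{N}_0^2:m+n\le K\}$, and $\Lambda^1_{M+1}=\{(m,n)\in\Lambda_{M+1}:m\in\{0,1\}\}$. Polynomials. $$G_{m,n}(x,y)=\sum_{\ell=0}^{\lfloor n/2\rfloor}(-1)^\ell\frac{x^{m+2\ell}y^{n-2\ell}}{(m+2\ell)!\,(n-2\ell)!}\quad(m\in\{0,1\},\ n\in\mathbb{N}_0),$$ $$H_{m,n}(x,y)=\sum_{\ell=1}^{1+\lfloor n/2\rfloor}(-1)^\ell\frac{x^{m+2\ell}y^{n-2\ell+2}}{(m+2\ell)!\,(n-2\ell+2)!}\quad(m,n\in\mathbb{N}_0).$$ Sign. $\sigma=1$ if $\frac{(s'(t),-r'(t))}{\sqrt{(r'(t))^2+(s'(t))^2}}$ equals $\vec n$ along $\Gamma$ near $(x^*,y^* )$, and $\sigma=-1$ if it equals $-\vec n$. Taylor coefficients. Let $[t^p]\,\phi(t)=\frac1{p!}\phi^{(p)}(0)$. Define $g_{m,n,p}=[t^p]\,G_{m,n}(r(t),s(t))$, $h_{m,n,p}=[t^p]\,H_{m,n}(r(t),s(t))$, $r_{m,n,p}=[t^p]\,(r(t))^m(s(t))^n$ for $0\le p\le M+1$, and $\tilde g_{m,n,p}=[t^p]\big(\nabla G_{m,n}(r(t),s(t))\cdot(s'(t),-r'(t))\big)$, $\tilde h_{m,n,p}=[t^p]\big(\nabla H_{m,n}(r(t),s(t))\cdot(s'(t),-r'(t))\big)$,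 $\tilde r_{m,n,p}=[t^p]\big((r(t))^m(s(t))^n\sqrt{(r'(t))^2+(s'(t))^2}\big)$ for $0\le p\le M$. Right-hand sides. $$F_p=\sum_{(m,n)\in\Lambda_{M-1}}(f_-^{(m,n)}-f_+^{(m,n)})h_{m,n,p}+\sum_{(m,n)\in\Lambda_{M+1}}\frac{g_1^{(m,n)}}{m!\,n!}r_{m,n,p},\qquad p=1,\ldots,M+1,$$ $$G_p=\sum_{(m,n)\in\Lambda_{M-1}}(f_-^{(m,n)}-f_+^{(m,n)})\tilde h_{m,n,p}+\sigma\sum_{(m,n)\in\Lambda_{M}}\frac{g^{(m,n)}}{m!\,n!}\tilde r_{m,n,p},\qquad p=0,\ldots,M.$$ Matrices. For $p=1,\ldots,M+1$, $$Q_p=\frac{1}{g_{0,p,p}\,\tilde g_{1,p-1,p-1}-g_{1,p-1,p}\,\tilde g_{0,p,p-1}}\begin{bmatrix}\tilde g_{1,p-1,p-1}&-g_{1,p-1,p}\\-\tilde g_{0,p,p-1}&g_{0,p,p}\end{bmatrix}.$$ Meaning of the coefficients. The recursion expresses each $U^{(m',n')}$ as a linear combination, with coefficients depending only on $\sigma$ and the derivatives of $r,s$ at $0$, of the quantities $f_\pm^{(m,n)}$, $g_1^{(m,n)}$, $g^{(m,n)}$ (treated as formal symbols). The coefficients of $-U^{(m',n')}$ in this expression are $T^\pm_{m',n',m,n}$, $T^{g_1}_{m',n',m,n}$, $T^g_{m',n',m,n}$. An empty sum is $0$. *)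

(* Defs.v *)
From Stdlib Require Import Reals Arith Lia FunctionalExtensionality.
From Coquelicot Require Import Coquelicot.

Set Implicit Arguments.
Unset Strict Implicit.
Unset Printing Implicit Defensive.

Open Scope R_scope.

(* Sets of points in the plane are predicates [R -> R -> Prop]. *)

Definition smooth1_at (f : R -> R) (t : R) : Prop :=
  forall k, ex_derive_n f k t.

(* [ex_diff_n f k x y]: the partial derivatives of order at most [k], taken in
   any order, exist and are continuous at [(x, y)]. *)
Definition smooth2_at (f : R -> R -> R) (x y : R) : Prop :=
  forall k, ex_diff_n f k x y.

Definition smooth2_near (f : R -> R -> R) (x0 y0 : R) : Prop :=
  locally_2d (smooth2_at f) x0 y0.

Definition dx (w : R -> R -> R) (x y : R) : R := Derive (fun z => w z y) x.
Definition dy (w : R -> R -> R) (x y : R) : R := Derive (fun z => w x z) y.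

Definition rect (l1 l2 l3 l4 x y : R) : Prop := l1 < x < l2 /\ l3 < y < l4.

Definition rect_boundary (l1 l2 l3 l4 x y : R) : Prop :=
  (l1 <= x <= l2 /\ l3 <= y <= l4) /\ ~ rect l1 l2 l3 l4 x y.

(* Smoothness of boundary data is only asked along each open side, where it
   is a property of the values on the boundary alone. *)
Definition smooth_on_sides (l1 l2 l3 l4 : R) (g0 : R -> R -> R) : Prop :=
  (forall x, l1 < x < l2 ->
     smooth1_at (fun z => g0 z l3) x /\ smooth1_at (fun z => g0 z l4) x) /\
  (forall y, l3 < y < l4 ->
     smooth1_at (fun z => g0 l1 z) y /\ smooth1_at (fun z => g0 l2 z) y).

Section Domain.

Variables (Omega : R -> R -> Prop) (psi : R -> R -> R).

Definition Gamma (x y : R) : Prop := Omega x y /\ psi x y = 0.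
Definition Omega_plus (x y : R) : Prop := Omega x y /\ psi x y > 0.
Definition Omega_minus (x y : R) : Prop := Omega x y /\ psi x y < 0.

(* The last clause says that small parameters exhaust the curve near
   [(x0, y0)]; asking it for every [eta] excludes curves coming back to
   [(x0, y0)], such as self-crossings. *)
Definition local_param (x0 y0 : R) (r s : R -> R) (eps : R) : Prop :=
  0 < eps /\
  r 0 = 0 /\ s 0 = 0 /\
  (forall t, Rabs t < eps ->
     smooth1_at r t /\ smooth1_at s t /\
     Derive r t ^ 2 + Derive s t ^ 2 > 0 /\
     Gamma (r t + x0) (s t + y0)) /\
  (forall eta, 0 < eta <= eps ->
     locally_2d (fun x y => Gamma x y ->
       exists t, Rabs t < eta /\ x = r t + x0 /\ y = s t + y0) x0 y0).

Definition smooth_curve : Prop :=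
  forall x0 y0, Gamma x0 y0 -> exists r s eps, local_param x0 y0 r s eps.

(* The third clause both places [Omega_minus] and [Omega_plus] on the two sides
   of the curve and orients the normal from the former towards the latter. *)
Definition unit_normal (nx ny : R -> R -> R) : Prop :=
  forall x0 y0, Gamma x0 y0 ->
    nx x0 y0 ^ 2 + ny x0 y0 ^ 2 = 1 /\
    (forall r s eps, local_param x0 y0 r s eps ->
       nx x0 y0 * Derive r 0 + ny x0 y0 * Derive s 0 = 0) /\
    (exists h0, 0 < h0 /\ forall h, 0 < h < h0 ->
       Omega_plus (x0 + h * nx x0 y0) (y0 + h * ny x0 y0) /\
       Omega_minus (x0 - h * nx x0 y0) (y0 - h * ny x0 y0)).

Definition lim_from (D : R -> R -> Prop) (w : R -> R -> R) (x0 y0 l : R) : Prop :=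
  filterlim (fun q : R * R => w (fst q) (snd q))
    (within (fun q => D (fst q) (snd q)) (locally (x0, y0))) (locally l).

Definition is_jump (w : R -> R -> R) (x0 y0 j : R) : Prop :=
  exists lp lm,
    lim_from Omega_plus w x0 y0 lp /\ lim_from Omega_minus w x0 y0 lm /\
    j = lp - lm.

Definition poisson_at (u f : R -> R -> R) (x y : R) : Prop :=
  ex_derive_n (fun z => u z y) 2 x /\ ex_derive_n (fun z => u x z) 2 y /\
  - (Derive_n (fun z => u z y) 2 x + Derive_n (fun z => u x z) 2 y) = f x y.

Definition orientation_sign (nx ny : R -> R -> R) (x0 y0 : R) (r s : R -> R)
    (sigma : R) : Prop :=
  let speed t := sqrt (Derive r t ^ 2 + Derive s t ^ 2) in
  (sigma = 1 /\
   locally 0 (fun t =>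
     Derive s t / speed t = nx (r t + x0) (s t + y0) /\
     - Derive r t / speed t = ny (r t + x0) (s t + y0))) \/
  (sigma = - 1 /\
   locally 0 (fun t =>
     Derive s t / speed t = - nx (r t + x0) (s t + y0) /\
     - Derive r t / speed t = - ny (r t + x0) (s t + y0))).

End Domain.

Definition interface_solution (l1 l2 l3 l4 : R) (psi nx ny : R -> R -> R)
    (f g0 g1 g u : R -> R -> R) : Prop :=
  let Omega := rect l1 l2 l3 l4 in
  (forall x y, Omega x y -> ~ Gamma Omega psi x y -> poisson_at u f x y) /\
  (forall x y, rect_boundary l1 l2 l3 l4 x y -> u x y = g0 x y) /\
  (forall x0 y0, Gamma Omega psi x0 y0 ->
     is_jump Omega psi u x0 y0 (g1 x0 y0)) /\
  (forall x0 y0, Gamma Omega psi x0 y0 ->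
     is_jump Omega psi
       (fun x y => dx u x y * nx x0 y0 + dy u x y * ny x0 y0) x0 y0 (g x0 y0)).

Definition smooth_extension (D : R -> R -> Prop) (w we : R -> R -> R)
    (x0 y0 : R) : Prop :=
  smooth2_near we x0 y0 /\
  locally_2d (fun x y => D x y -> we x y = w x y) x0 y0.

Definition in_Lambda (K m n : nat) : Prop := (m + n <= K)%nat.

Definition in_Lambda1 (K m n : nat) : Prop :=
  (m + n <= K)%nat /\ (m = 0%nat \/ m = 1%nat).

Definition sum_Lambda (V : AbelianMonoid) (K : nat) (a : nat -> nat -> V) : V :=
  sum_n (fun m => sum_n (fun n => a m n) (K - m)) K.

Definition Gpoly (m n : nat) (x y : R) : R :=
  sum_n (fun l : nat =>
    (-1) ^ l * (x ^ (m + 2 * l) * y ^ (n - 2 * l)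
      / (INR (fact (m + 2 * l)) * INR (fact (n - 2 * l))))) (n / 2).

(* In natural numbers [n + 2 - 2 * l] is exact on the range of summation,
   whereas [n - 2 * l + 2] would be truncated at [l = 1 + n / 2]. *)
Definition Hpoly (m n : nat) (x y : R) : R :=
  sum_n_m (fun l : nat =>
    (-1) ^ l * (x ^ (m + 2 * l) * y ^ (n + 2 - 2 * l)
      / (INR (fact (m + 2 * l)) * INR (fact (n + 2 - 2 * l))))) 1 (1 + n / 2).

Definition tcoef (phi : R -> R) (p : nat) : R := Derive_n phi p 0 / INR (fact p).

Inductive symbol : Set :=
  | sym_fp (m n : nat) | sym_fm (m n : nat) | sym_g1 (m n : nat) | sym_g (m n : nat).

Definition symbol_eq_dec (a b : symbol) : {a = b} + {a <> b}.
Proof. decide equality; apply Nat.eq_dec. Defined.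

(* Formal linear combinations of the symbols [f_+^(m,n)], [f_-^(m,n)],
   [g_1^(m,n)], [g^(m,n)], given by their families of coefficients. *)
Definition lincomb : Type := symbol -> R.

Definition lincomb_AbelianMonoid_mixin : AbelianMonoid.mixin_of lincomb.
Proof.
  apply (AbelianMonoid.Mixin lincomb (fun v w a => v a + w a) (fun _ => 0));
    intros; apply functional_extensionality; intros a; ring.
Defined.

Definition lincomb_AbelianGroup_mixin : AbelianGroup.mixin_of
  (AbelianMonoid.Pack lincomb lincomb_AbelianMonoid_mixin lincomb).
Proof.
  apply (AbelianGroup.Mixin
    (AbelianMonoid.Pack lincomb lincomb_AbelianMonoid_mixin lincomb)
    (fun (v : lincomb) a => - v a)).
  intros v; apply functional_extensionality; intros a; exact (Rplus_opp_r (v a)).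
Defined.

Definition lincomb_AbelianGroup_class : AbelianGroup.class_of lincomb :=
  AbelianGroup.Class lincomb lincomb_AbelianMonoid_mixin lincomb_AbelianGroup_mixin.

Definition lincomb_ModuleSpace_mixin : ModuleSpace.mixin_of R_Ring
  (AbelianGroup.Pack lincomb lincomb_AbelianGroup_class lincomb).
Proof.
  apply (ModuleSpace.Mixin R_Ring
    (AbelianGroup.Pack lincomb lincomb_AbelianGroup_class lincomb)
    (fun (c : R) (v : lincomb) a => c * v a));
    intros; apply functional_extensionality; intros a;
    unfold plus, mult, one; simpl; unfold mult, one; simpl; ring.
Defined.

Definition formal : ModuleSpace R_Ring :=
  ModuleSpace.Pack R_Ring lincomb
    (ModuleSpace.Class R_Ring lincomb
      lincomb_AbelianGroup_class lincomb_ModuleSpace_mixin) lincomb.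

Definition monomial (a : symbol) : formal :=
  fun b => if symbol_eq_dec a b then 1 else 0.

Section Coefficients.

Variables (r s : R -> R).

Definition along_conormal (w : R -> R -> R) (t : R) : R :=
  dx w (r t) (s t) * Derive s t + dy w (r t) (s t) * - Derive r t.

Definition gc (m n p : nat) : R := tcoef (fun t => Gpoly m n (r t) (s t)) p.
Definition hc (m n p : nat) : R := tcoef (fun t => Hpoly m n (r t) (s t)) p.
Definition rc (m n p : nat) : R := tcoef (fun t => r t ^ m * s t ^ n) p.

Definition gtc (m n p : nat) : R := tcoef (along_conormal (Gpoly m n)) p.
Definition htc (m n p : nat) : R := tcoef (along_conormal (Hpoly m n)) p.
Definition rtc (m n p : nat) : R :=
  tcoef (fun t => r t ^ m * s t ^ n * sqrt (Derive r t ^ 2 + Derive s t ^ 2)) p.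

Definition Qdet (p : nat) : R :=
  gc 0 p p * gtc 1 (p - 1) (p - 1) - gc 1 (p - 1) p * gtc 0 p (p - 1).

(* 2x2 matrices are pairs of rows. *)
Definition Qmat (p : nat) : (R * R) * (R * R) :=
  ((/ Qdet p * gtc 1 (p - 1) (p - 1), / Qdet p * - gc 1 (p - 1) p),
   (/ Qdet p * - gtc 0 p (p - 1),     / Qdet p * gc 0 p p)).

(* The recursion makes sense for data in any real vector space [V]: the reals
   give the actual jumps, formal linear combinations the transmission
   coefficients. *)
Section Recursion.

Variables (V : ModuleSpace R_Ring) (M : nat) (sigma : R).
Variables fp fm g1 g : nat -> nat -> V.

Definition mat2_apply (A : (R * R) * (R * R)) (v : V * V) : V * V :=
  (plus (scal (fst (fst A)) (fst v)) (scal (snd (fst A)) (snd v)),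
   plus (scal (fst (snd A)) (fst v)) (scal (snd (snd A)) (snd v))).

Definition rhsF (p : nat) : V :=
  plus
    (sum_Lambda (M - 1) (fun m n => scal (hc m n p) (minus (fm m n) (fp m n))))
    (sum_Lambda (M + 1) (fun m n =>
       scal (rc m n p / (INR (fact m) * INR (fact n))) (g1 m n))).

Definition rhsG (p : nat) : V :=
  plus
    (sum_Lambda (M - 1) (fun m n => scal (htc m n p) (minus (fm m n) (fp m n))))
    (scal sigma (sum_Lambda M (fun m n =>
       scal (rtc m n p / (INR (fact m) * INR (fact n))) (g m n)))).

Definition rec_step (U : nat -> nat -> V) (p : nat) : V * V :=
  minus
    (mat2_apply (Qmat p) (rhsF p, rhsG (p - 1)))
    (sum_n_m (fun n => mat2_apply (Qmat p)
       (plus (scal (gc 0 n p) (U 0%nat n))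
             (scal (gc 1 (n - 1) p) (U 1%nat (n - 1)%nat)),
        plus (scal (gtc 0 n (p - 1)) (U 0%nat n))
             (scal (gtc 1 (n - 1) (p - 1)) (U 1%nat (n - 1)%nat))))
       1 (p - 1)).

Definition satisfies_recursion (U : nat -> nat -> V) : Prop :=
  U 0%nat 0%nat = g1 0%nat 0%nat /\
  forall p, (1 <= p <= M + 1)%nat -> (U 0%nat p, U 1%nat (p - 1)%nat) = rec_step U p.

(* [rec_table p] holds [U^(m,n)] at [m + n <= p], [m = 0, 1]; its other
   entries are irrelevant. *)
Fixpoint rec_table (p : nat) : nat -> nat -> V :=
  match p with
  | O => fun _ _ => g1 0%nat 0%nat
  | S q =>
      let U := rec_table q in
      let v := rec_step U p in
      fun m n =>
        if (m + n =? p)%nat then match m with O => fst v | S _ => snd v end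
        else U m n
  end.

Definition rec_solution (m n : nat) : V := rec_table (m + n) m n.

Lemma rec_table_stable (p m n : nat) :
  (m + n <= p)%nat -> rec_table p m n = rec_solution m n.
Proof.
  unfold rec_solution; induction p as [|p IH]; intros H.
  - now replace (m + n)%nat with 0%nat by lia.
  - destruct (Nat.eq_dec (m + n) (S p)) as [E|E].
    + now rewrite E.
    + simpl; destruct (Nat.eqb_spec (m + n) (S p)); [easy | apply IH; lia].
Qed.

Lemma rec_solution_correct : satisfies_recursion rec_solution.
Proof.
  split; [reflexivity|]; intros [|q] Hp; [lia|].
  assert (E : rec_step rec_solution (S q) = rec_step (rec_table q) (S q)).
  { unfold rec_step; f_equal; apply sum_n_m_ext_loc; intros n Hn.
    now rewrite !rec_table_stable by lia. }
  rewrite E; unfold rec_solution.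
  replace (0 + S q)%nat with (S q) by lia.
  replace (1 + (S q - 1))%nat with (S q) by lia.
  assert (T : forall m n, (m + n)%nat = S q -> rec_table (S q) m n =
    match m with
    | O => fst (rec_step (rec_table q) (S q))
    | S _ => snd (rec_step (rec_table q) (S q))
    end).
  { intros m n H; simpl rec_table; now rewrite H, Nat.eqb_refl. }
  rewrite !T by lia; now destruct (rec_step _ _).
Qed.

End Recursion.

Definition formal_jump (M : nat) (sigma : R) : nat -> nat -> formal :=
  rec_solution M sigma
    (fun m n => monomial (sym_fp m n)) (fun m n => monomial (sym_fm m n))
    (fun m n => monomial (sym_g1 m n)) (fun m n => monomial (sym_g m n)).

Definition T_plus (M : nat) (sigma : R) (m' n' m n : nat) : R :=
  - formal_jump M sigma m' n' (sym_fp m n).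
Definition T_minus (M : nat) (sigma : R) (m' n' m n : nat) : R :=
  - formal_jump M sigma m' n' (sym_fm m n).
Definition T_g1 (M : nat) (sigma : R) (m' n' m n : nat) : R :=
  - formal_jump M sigma m' n' (sym_g1 m n).
Definition T_g (M : nat) (sigma : R) (m' n' m n : nat) : R :=
  - formal_jump M sigma m' n' (sym_g m n).

End Coefficients.

(* [partial_derive m n w] differentiates [m] times in [x] and [n] times in [y]. *)
Definition jet2 (w : R -> R -> R) (x0 y0 : R) (m n : nat) : R :=
  partial_derive m n w x0 y0.

(* Main.v *)
Require Import Defs.
From Stdlib Require Import Reals Arith Lia Lra FunctionalExtensionality.
From Coquelicot Require Import Coquelicot.
Open Scope R_scope.

(** The jump [v = u_+ - u_-] of the two smooth extensions is itself smooth near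
    the point of the interface, and the jets of the data determine its jet
    there.

    On the side where an extension agrees with [u] it solves the Poisson
    equation, and so do all derivatives of the equation; the point is a limit
    of points of either side, along the normal, so these identities hold at the
    point by continuity ([extension_poisson_jet]).  They express every
    [v^(m+2,n)] by [-v^(m,n+2)] and a derivative of [f_- - f_+]; hence the
    Taylor polynomial of [v] is a combination of the polynomials [Gpoly], with
    the unknowns [v^(0,n)] and [v^(1,n)] as coefficients, minus a known
    combination of the polynomials [Hpoly] ([jet_elimination],
    [linear_functional_elimination]).

    One-sided limits are values of the extensions, so along the curve [v] equals
    [g1], and the derivative of [v] in the direction [(s', -r')] equals
    [sigma g] times the speed ([interface_jumps], [normal_jump_along_curve]).
    The Taylor coefficients of both identities at [t = 0] are linear equations
    for the unknowns ([value_system], [normal_system]).  Replacing functions by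
    their Taylor polynomials is harmless here, because the jet of a composition
    only depends on the jets of its constituents ([same_jet_comp]).

    A homogeneous polynomial of degree [d] along a curve through the origin is
    [O(t^d)], so the system is block triangular, with one 2x2 block for each
    degree.  The polynomials [Gpoly 0 d] and [Gpoly 1 (d - 1)] are the real and
    imaginary parts of [(y + i x)^d / d!]; with [z = s'(0) + i r'(0)] the
    determinant of the block is [d |z^d / d!|^2], which is positive
    ([Qdet_neq_0]).  Cramer's rule on each block is the recursion
    ([recursion_of_system]).

    The recursion makes sense in every real vector space and commutes with
    linear maps ([recursion_linear]).  Substituting the actual derivatives for
    the symbols is a linear map, so the formal recursion that defines the
    transmission coefficients evaluates to the actual jumps, which is the
    transmission identity.  The numbers entering the recursion are Taylor
    coefficients along the curve, so two curves with the same jet of order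
    [M + 1] have the same transmission coefficients ([same_coefs_same_jet]). *)

(** * Smooth functions of two variables *)

Lemma locally_2d_locally_2d (P : R -> R -> Prop) (x y : R) :
  locally_2d P x y -> locally_2d (fun u v => locally_2d P u v) x y.
Proof.
  intros H; apply locally_2d_locally, locally_locally in H.
  apply locally_2d_locally; revert H; apply filter_imp; intros [u v] H.
  now apply locally_2d_locally.
Qed.

Lemma smooth2_near_open (w : R -> R -> R) (x y : R) :
  smooth2_near w x y -> locally_2d (smooth2_near w) x y.
Proof. apply locally_2d_locally_2d. Qed.

Lemma smooth2_near_at (w : R -> R -> R) (x y : R) :
  smooth2_near w x y -> smooth2_at w x y.
Proof. apply locally_2d_singleton. Qed.

Lemma smooth2_near_imp (v w : R -> R -> R) (x y : R) :
  (forall x' y', smooth2_at v x' y' -> smooth2_at w x' y') ->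
  smooth2_near v x y -> smooth2_near w x y.
Proof.
  intros H; apply locally_2d_impl, locally_2d_forall; auto.
Qed.

Lemma smooth2_near_dx (w : R -> R -> R) (x y : R) :
  smooth2_near w x y -> smooth2_near (dx w) x y.
Proof.
  apply smooth2_near_imp; intros x' y' H k; exact (ex_diff_n_deriv_aux1 _ _ _ _ (H (S k))).
Qed.

Lemma smooth2_near_dy (w : R -> R -> R) (x y : R) :
  smooth2_near w x y -> smooth2_near (dy w) x y.
Proof.
  apply smooth2_near_imp; intros x' y' H k; exact (ex_diff_n_deriv_aux2 _ _ _ _ (H (S k))).
Qed.

Lemma smooth2_near_continuous (w : R -> R -> R) (x y : R) :
  smooth2_near w x y -> continuity_2d_pt w x y.
Proof. intros H; exact (proj1 (smooth2_near_at _ _ _ H 0%nat)). Qed.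

Lemma smooth2_near_is_derive_x (w : R -> R -> R) (x y : R) :
  smooth2_near w x y -> is_derive (fun z => w z y) x (dx w x y).
Proof.
  intros H; apply Derive_correct.
  exact (proj1 (proj2 (smooth2_near_at _ _ _ H 1%nat))).
Qed.

Lemma smooth2_near_is_derive_y (w : R -> R -> R) (x y : R) :
  smooth2_near w x y -> is_derive (fun z => w x z) y (dy w x y).
Proof.
  intros H; apply Derive_correct.
  exact (proj1 (proj2 (proj2 (smooth2_near_at _ _ _ H 1%nat)))).
Qed.

Lemma dx_ext_loc (v w : R -> R -> R) (x y : R) :
  locally_2d (fun a b => v a b = w a b) x y ->
  locally_2d (fun a b => dx v a b = dx w a b) x y.
Proof.
  intros E; apply locally_2d_locally_2d in E; revert E.
  apply locally_2d_impl, locally_2d_forall; intros a b E.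
  apply Derive_ext_loc; exact (locally_2d_1d_const_y _ _ _ E).
Qed.

Lemma dy_ext_loc (v w : R -> R -> R) (x y : R) :
  locally_2d (fun a b => v a b = w a b) x y ->
  locally_2d (fun a b => dy v a b = dy w a b) x y.
Proof.
  intros E; apply locally_2d_locally_2d in E; revert E.
  apply locally_2d_impl, locally_2d_forall; intros a b E.
  apply Derive_ext_loc; exact (locally_2d_1d_const_x _ _ _ E).
Qed.

Lemma is_derive_axpy_x (v w : R -> R -> R) (c x y : R) :
  smooth2_near v x y -> smooth2_near w x y ->
  is_derive (fun z => v z y + c * w z y) x (dx v x y + c * dx w x y).
Proof.
  intros Hv Hw; apply (is_derive_plus (fun z => v z y) (fun z => c * w z y)).
  - now apply smooth2_near_is_derive_x.
  - apply (is_derive_scal (fun z => w z y)); now apply smooth2_near_is_derive_x.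
Qed.

Lemma is_derive_axpy_y (v w : R -> R -> R) (c x y : R) :
  smooth2_near v x y -> smooth2_near w x y ->
  is_derive (fun z => v x z + c * w x z) y (dy v x y + c * dy w x y).
Proof.
  intros Hv Hw; apply (is_derive_plus (fun z => v x z) (fun z => c * w x z)).
  - now apply smooth2_near_is_derive_y.
  - apply (is_derive_scal (fun z => w x z)); now apply smooth2_near_is_derive_y.
Qed.

Lemma dx_axpy (v w : R -> R -> R) (c x y : R) :
  smooth2_near v x y -> smooth2_near w x y ->
  dx (fun a b => v a b + c * w a b) x y = dx v x y + c * dx w x y.
Proof. intros Hv Hw; apply is_derive_unique; now apply is_derive_axpy_x. Qed.

Lemma dy_axpy (v w : R -> R -> R) (c x y : R) :
  smooth2_near v x y -> smooth2_near w x y ->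
  dy (fun a b => v a b + c * w a b) x y = dy v x y + c * dy w x y.
Proof. intros Hv Hw; apply is_derive_unique; now apply is_derive_axpy_y. Qed.

(** Sums and scalar multiples are treated together, in the form [v + c w]; this
    is the only algebraic operation needed on functions of two variables. *)
Lemma smooth2_near_axpy (v w : R -> R -> R) (c x y : R) :
  smooth2_near v x y -> smooth2_near w x y ->
  smooth2_near (fun a b => v a b + c * w a b) x y.
Proof.
  intros Hv Hw.
  generalize (locally_2d_and _ _ _ _ (smooth2_near_open _ _ _ Hv) (smooth2_near_open _ _ _ Hw)).
  apply locally_2d_impl, locally_2d_forall; clear x y Hv Hw.
  intros x y [Hv Hw] k; revert v w x y Hv Hw.
  induction k as [|k IH]; intros v w x y Hv Hw.
  - split; [|easy].
    apply continuity_2d_pt_plus; [now apply smooth2_near_continuous|].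
    apply continuity_2d_pt_mult; [apply continuity_2d_pt_const|now apply smooth2_near_continuous].
  - split; [exact (proj1 (ex_diff_n_m _ _ (Nat.le_0_l k) _ _ _ (IH v w x y Hv Hw)))|].
    assert (L := locally_2d_and _ _ _ _ (smooth2_near_open _ _ _ Hv) (smooth2_near_open _ _ _ Hw)).
    repeat split.
    + exists (dx v x y + c * dx w x y); now apply is_derive_axpy_x.
    + exists (dy v x y + c * dy w x y); now apply is_derive_axpy_y.
    + apply ex_diff_n_ext_loc with (2 := IH _ _ _ _ (smooth2_near_dx _ _ _ Hv) (smooth2_near_dx _ _ _ Hw)).
      revert L; apply locally_2d_impl, locally_2d_forall; intros a b [Ha Hb].
      symmetry; now apply dx_axpy.
    + apply ex_diff_n_ext_loc with (2 := IH _ _ _ _ (smooth2_near_dy _ _ _ Hv) (smooth2_near_dy _ _ _ Hw)).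
      revert L; apply locally_2d_impl, locally_2d_forall; intros a b [Ha Hb].
      symmetry; now apply dy_axpy.
Qed.

(** A coinduction principle: since the partial derivatives stay in the class,
    differentiability of any order is an induction on that order. *)
Lemma smooth2_of_closed (P : (R -> R -> R) -> Prop) :
  (forall w, P w -> exists wx wy, P wx /\ P wy /\ forall x y,
     continuity_2d_pt w x y /\
     is_derive (fun z => w z y) x (wx x y) /\ is_derive (fun z => w x z) y (wy x y)) ->
  forall w x y, P w -> smooth2_near w x y.
Proof.
  intros H w x y Pw; apply locally_2d_forall; clear x y; intros x y k.
  revert w x y Pw; induction k as [|k IH]; intros w x y Pw;
    destruct (H w Pw) as (wx & wy & Px & Py & D).
  - split; [apply D|easy].
  - destruct (D x y) as (C & Dx & Dy); split; [exact C|].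
    split; [now exists (wx x y)|]; split; [now exists (wy x y)|]; split.
    + apply ex_diff_n_ext_loc with (2 := IH wx x y Px).
      apply locally_2d_forall; intros u v; symmetry; apply is_derive_unique, D.
    + apply ex_diff_n_ext_loc with (2 := IH wy x y Py).
      apply locally_2d_forall; intros u v; symmetry; apply is_derive_unique, D.
Qed.

Lemma partial_derive_dy (m n : nat) (w : R -> R -> R) (x y : R) :
  partial_derive m n (dy w) x y = partial_derive m (S n) w x y.
Proof.
  unfold partial_derive; apply Derive_n_ext; intros t.
  replace (S n) with (n + 1)%nat by lia.
  exact (Derive_n_comp (fun z => w t z) n 1 y).
Qed.

(** Unlike [partial_derive_dy] this uses the symmetry of second derivatives,
    because [partial_derive] differentiates in [y] first. *)
Lemma partial_derive_dx (m n : nat) (w : R -> R -> R) (x y : R) :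
  smooth2_near w x y -> partial_derive m n (dx w) x y = partial_derive (S m) n w x y.
Proof.
  intros H; replace (S m) with (m + 1)%nat by lia.
  unfold partial_derive; rewrite <- Derive_n_comp.
  apply Derive_n_ext_loc.
  assert (L := locally_2d_1d_const_y _ _ _ (smooth2_near_open _ _ _ H)); revert L.
  apply filter_imp; intros t Ht; symmetry.
  apply (Derive_partial_derive_aux1 n w t y).
  revert Ht; apply locally_2d_impl, locally_2d_forall; intros a b Hab; apply Hab.
Qed.

Lemma partial_derive_continuous (m n : nat) (w : R -> R -> R) (x y : R) :
  smooth2_near w x y -> continuity_2d_pt (partial_derive m n w) x y.
Proof.
  intros H; assert (H' := ex_diff_n_deriv (m + n) m n (le_n _) w x y
    (smooth2_near_at _ _ _ H (m + n)%nat)).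
  destruct (m + n - (m + n))%nat; apply H'.
Qed.

Lemma partial_derive_axpy (m n : nat) (v w : R -> R -> R) (c x y : R) :
  smooth2_near v x y -> smooth2_near w x y ->
  partial_derive m n (fun a b => v a b + c * w a b) x y =
  partial_derive m n v x y + c * partial_derive m n w x y.
Proof.
  revert v w x y; induction m as [|m IHm].
  - induction n as [|n IHn]; intros v w x y Hv Hw; [reflexivity|].
    rewrite <- !partial_derive_dy, <- IHn by now apply smooth2_near_dy.
    apply partial_derive_ext_loc.
    generalize (locally_2d_and _ _ _ _ (smooth2_near_open _ _ _ Hv) (smooth2_near_open _ _ _ Hw)).
    apply locally_2d_impl, locally_2d_forall; intros a b [Ha Hb]; now apply dy_axpy.
  - intros v w x y Hv Hw.
    rewrite <- !partial_derive_dx by (try apply smooth2_near_axpy; assumption).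
    rewrite <- IHm by now apply smooth2_near_dx.
    apply partial_derive_ext_loc.
    generalize (locally_2d_and _ _ _ _ (smooth2_near_open _ _ _ Hv) (smooth2_near_open _ _ _ Hw)).
    apply locally_2d_impl, locally_2d_forall; intros a b [Ha Hb]; now apply dx_axpy.
Qed.

(** * Smooth functions along a smooth curve *)

Definition smooth1_near (f : R -> R) (t : R) : Prop := locally t (smooth1_at f).

Lemma smooth1_near_open (f : R -> R) (t : R) :
  smooth1_near f t -> locally t (smooth1_near f).
Proof. apply locally_locally. Qed.

Lemma smooth1_near_is_derive (f : R -> R) (t : R) :
  smooth1_near f t -> is_derive f t (Derive f t).
Proof.
  intros H; apply Derive_correct; exact (locally_singleton _ _ H 1%nat).
Qed.

Lemma smooth1_near_continuous (f : R -> R) (t : R) :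
  smooth1_near f t -> continuous f t.
Proof.
  intros H; apply (ex_derive_continuous f t); exact (locally_singleton _ _ H 1%nat).
Qed.

Lemma Derive_n_S (f : R -> R) (k : nat) (t : R) :
  Derive_n f (S k) t = Derive_n (Derive f) k t.
Proof.
  replace (S k) with (k + 1)%nat by lia; symmetry; exact (Derive_n_comp f k 1 t).
Qed.

Lemma smooth1_near_Derive (f : R -> R) (t : R) :
  smooth1_near f t -> smooth1_near (Derive f) t.
Proof.
  intros Hf; refine (filter_imp _ _ _ Hf); intros z H [|k]; [exact I|].
  apply (ex_derive_ext (Derive_n f (S k))); [intros; apply Derive_n_S|exact (H (S (S k)))].
Qed.

Lemma locally_2d_comp (P : R -> R -> Prop) (r s : R -> R) (t : R) :
  continuous r t -> continuous s t -> locally_2d P (r t) (s t) ->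
  locally t (fun z => P (r z) (s z)).
Proof.
  intros Hr Hs [d H].
  assert (Br : locally t (fun z => ball (r t) d (r z))) by exact (Hr _ (locally_ball _ d)).
  assert (Bs : locally t (fun z => ball (s t) d (s z))) by exact (Hs _ (locally_ball _ d)).
  generalize (filter_and _ _ Br Bs); apply filter_imp; intros z []; now apply H.
Qed.

Lemma is_derive_comp_2d (w : R -> R -> R) (r s : R -> R) (t r' s' : R) :
  smooth2_near w (r t) (s t) -> is_derive r t r' -> is_derive s t s' ->
  is_derive (fun z => w (r z) (s z)) t (dx w (r t) (s t) * r' + dy w (r t) (s t) * s').
Proof.
  intros H Hr Hs; apply is_derive_Reals.
  apply derivable_pt_lim_comp_2d; [|now apply is_derive_Reals ..].
  apply filterdiff_differentiable_pt_lim.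
  apply (is_derive_filterdiff w (r t) (s t) (dx w) (dy w (r t) (s t))).
  - apply (proj1 (locally_2d_locally (fun a b => is_derive (fun z => w z b) a (dx w a b)) (r t) (s t))).
    generalize (smooth2_near_open _ _ _ H); apply locally_2d_impl, locally_2d_forall.
    intros a b; apply smooth2_near_is_derive_x.
  - now apply smooth2_near_is_derive_y.
  - apply continuity_2d_pt_filterlim, smooth2_near_continuous, smooth2_near_dx, H.
Qed.

Lemma locally_is_derive_comp_2d (w : R -> R -> R) (r s : R -> R) (t : R) :
  smooth2_near w (r t) (s t) -> smooth1_near r t -> smooth1_near s t ->
  locally t (fun z => is_derive (fun z => w (r z) (s z)) z
    (dx w (r z) (s z) * Derive r z + dy w (r z) (s z) * Derive s z)).
Proof.
  intros H Hr Hs.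
  assert (L := locally_2d_comp _ r s t (smooth1_near_continuous _ _ Hr)
    (smooth1_near_continuous _ _ Hs) (smooth2_near_open _ _ _ H)).
  generalize (filter_and _ _ L (filter_and _ _ (smooth1_near_open _ _ Hr) (smooth1_near_open _ _ Hs))).
  apply filter_imp; intros z (? & ? & ?).
  apply is_derive_comp_2d; auto using smooth1_near_is_derive.
Qed.

(** All the closure properties of smooth functions of one variable are proved
    at once: the functions built from smooth ones by these operations have
    derivatives of the same kind.  The inverse square root is taken as
    primitive, rather than the square root or the inverse, because its
    derivative only involves itself and the derivative of its argument. *)
Inductive smooth_built (t : R) : (R -> R) -> Prop :=
  | built_base f : smooth1_near f t -> smooth_built t f
  | built_plus f g : smooth_built t f -> smooth_built t g -> smooth_built t (fun z => f z + g z)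
  | built_mult f g : smooth_built t f -> smooth_built t g -> smooth_built t (fun z => f z * g z)
  | built_rsqrt f : smooth1_near f t -> 0 < f t -> smooth_built t (fun z => / sqrt (f z))
  | built_comp w r s : smooth2_near w (r t) (s t) -> smooth1_near r t -> smooth1_near s t ->
      smooth_built t (fun z => w (r z) (s z)).

Lemma smooth1_near_const (c t : R) : smooth1_near (fun _ => c) t.
Proof. unfold smooth1_near; apply filter_forall; intros z k; apply ex_derive_n_const. Qed.

Lemma locally_pos (f : R -> R) (t : R) :
  continuous f t -> 0 < f t -> locally t (fun z => 0 < f z).
Proof. intros C H; exact (C _ (open_gt 0 (f t) H)). Qed.

Lemma smooth_built_open (f : R -> R) (t : R) :
  smooth_built t f -> locally t (fun z => smooth_built z f).
Proof.
  induction 1 as [f H|f g _ IHf _ IHg|f g _ IHf _ IHg|f H P|w r s H Hr Hs].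
  - generalize (smooth1_near_open _ _ H); apply filter_imp; now constructor.
  - generalize (filter_and _ _ IHf IHg); apply filter_imp; intros z []; now constructor.
  - generalize (filter_and _ _ IHf IHg); apply filter_imp; intros z []; now constructor.
  - generalize (filter_and _ _ (smooth1_near_open _ _ H)
      (locally_pos f t (smooth1_near_continuous _ _ H) P)).
    apply filter_imp; intros z []; now constructor.
  - assert (L := locally_2d_comp _ r s t (smooth1_near_continuous _ _ Hr)
      (smooth1_near_continuous _ _ Hs) (smooth2_near_open _ _ _ H)).
    generalize (filter_and _ _ L (filter_and _ _ (smooth1_near_open _ _ Hr) (smooth1_near_open _ _ Hs))).
    apply filter_imp; intros z (? & ? & ?); now constructor.
Qed.

Lemma locally_is_derive_rsqrt (f : R -> R) (t : R) :
  smooth1_near f t -> 0 < f t ->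
  locally t (fun z => is_derive (fun y => / sqrt (f y)) z
    (- / 2 * Derive f z * (/ sqrt (f z) * (/ sqrt (f z) * / sqrt (f z))))).
Proof.
  intros H P; generalize (filter_and _ _ (smooth1_near_open _ _ H)
    (locally_pos f t (smooth1_near_continuous _ _ H) P)).
  apply filter_imp; clear t H P; intros t [H P]; assert (S := sqrt_lt_R0 _ P).
  auto_derive.
  - repeat split; try lra; exists (Derive f t); now apply smooth1_near_is_derive.
  - change (Derive (fun x => f x) t) with (Derive f t); field; lra.
Qed.

Lemma smooth_built_derive (f : R -> R) (t : R) :
  smooth_built t f ->
  exists g, smooth_built t g /\ locally t (fun z => is_derive f z (g z)).
Proof.
  induction 1 as [f H|f g Hf [f' [If Df]] Hg [g' [Ig Dg]]
    |f g Hf [f' [If Df]] Hg [g' [Ig Dg]]|f H P|w r s H Hr Hs].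
  - exists (Derive f); split; [constructor; now apply smooth1_near_Derive|].
    generalize (smooth1_near_open _ _ H); apply filter_imp; exact (smooth1_near_is_derive f).
  - exists (fun z => f' z + g' z); split; [now constructor|].
    generalize (filter_and _ _ Df Dg); apply filter_imp; intros z [].
    now apply (is_derive_plus f g).
  - exists (fun z => f' z * g z + f z * g' z); split; [constructor; now constructor|].
    generalize (filter_and _ _ Df Dg); apply filter_imp; intros z [].
    apply (is_derive_mult f g z (f' z) (g' z)); auto; intros; apply Rmult_comm.
  - exists (fun z => - / 2 * Derive f z * (/ sqrt (f z) * (/ sqrt (f z) * / sqrt (f z)))); split.
    + repeat apply built_mult; try now apply built_rsqrt.
      * constructor; apply smooth1_near_const.
      * constructor; now apply smooth1_near_Derive.
    + now apply locally_is_derive_rsqrt.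
  - exists (fun z => dx w (r z) (s z) * Derive r z + dy w (r z) (s z) * Derive s z); split.
    + apply built_plus; apply built_mult.
      * apply (built_comp t (dx w)); auto using smooth2_near_dx.
      * apply (built_base t (Derive r)); now apply smooth1_near_Derive.
      * apply (built_comp t (dy w)); auto using smooth2_near_dy.
      * apply (built_base t (Derive s)); now apply smooth1_near_Derive.
    + now apply locally_is_derive_comp_2d.
Qed.

Lemma smooth_built_smooth (f : R -> R) (t : R) :
  smooth_built t f -> smooth1_near f t.
Proof.
  intros H; refine (filter_imp _ _ _ (smooth_built_open f t H)); clear t H.
  intros t H k; revert f t H; induction k as [|k IH]; intros f t H; [exact I|].
  destruct (smooth_built_derive f t H) as (g & Hg & D).
  destruct k as [|k]; [exists (g t); exact (locally_singleton _ _ D)|].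
  apply (ex_derive_ext_loc (Derive_n g k)); [|exact (IH g t Hg)].
  apply locally_locally in D; revert D; apply filter_imp; intros z D.
  rewrite Derive_n_S; apply Derive_n_ext_loc; revert D; apply filter_imp.
  intros a Da; symmetry; now apply is_derive_unique.
Qed.

Lemma smooth1_near_plus (f g : R -> R) (t : R) :
  smooth1_near f t -> smooth1_near g t -> smooth1_near (fun z => f z + g z) t.
Proof. intros; apply smooth_built_smooth; constructor; now constructor. Qed.

Lemma smooth1_near_mult (f g : R -> R) (t : R) :
  smooth1_near f t -> smooth1_near g t -> smooth1_near (fun z => f z * g z) t.
Proof. intros; apply smooth_built_smooth; constructor; now constructor. Qed.

Lemma smooth1_near_rsqrt (f : R -> R) (t : R) :
  smooth1_near f t -> 0 < f t -> smooth1_near (fun z => / sqrt (f z)) t.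
Proof. intros; apply smooth_built_smooth; now constructor. Qed.

Lemma smooth1_near_comp (w : R -> R -> R) (r s : R -> R) (t : R) :
  smooth2_near w (r t) (s t) -> smooth1_near r t -> smooth1_near s t ->
  smooth1_near (fun z => w (r z) (s z)) t.
Proof. intros; apply smooth_built_smooth; now constructor. Qed.

Lemma smooth1_near_ext_loc (f g : R -> R) (t : R) :
  locally t (fun z => f z = g z) -> smooth1_near f t -> smooth1_near g t.
Proof.
  intros E H; apply locally_locally in E.
  refine (filter_imp _ _ _ (filter_and _ _ E H)); intros z [E' H'] k; now apply ex_derive_n_ext_loc with (1 := E').
Qed.

(** * Jets of functions of one variable *)

Definition same_jet (K : nat) (f g : R -> R) : Prop :=
  forall k, (k <= K)%nat -> Derive_n f k 0 = Derive_n g k 0.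

Lemma same_jet_le (K L : nat) (f g : R -> R) :
  (L <= K)%nat -> same_jet K f g -> same_jet L f g.
Proof. intros H J k Hk; apply J; lia. Qed.

Lemma same_jet_refl (K : nat) (f : R -> R) : same_jet K f f.
Proof. now intros k _. Qed.

Lemma same_jet_trans (K : nat) (f g h : R -> R) :
  same_jet K f g -> same_jet K g h -> same_jet K f h.
Proof. intros H1 H2 k Hk; rewrite H1; auto. Qed.

Lemma same_jet_sym (K : nat) (f g : R -> R) : same_jet K f g -> same_jet K g f.
Proof. intros H k Hk; symmetry; auto. Qed.

Lemma same_jet_ext_loc (K : nat) (f g : R -> R) :
  locally 0 (fun t => f t = g t) -> same_jet K f g.
Proof. intros H k _; now apply Derive_n_ext_loc. Qed.

Lemma same_jet_Derive (K : nat) (f g : R -> R) :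
  same_jet (S K) f g -> same_jet K (Derive f) (Derive g).
Proof. intros H k Hk; rewrite <- !Derive_n_S; apply H; lia. Qed.

(** Jets of order [K + 1] are compared through the jets of order [K] of the
    derivatives; all comparisons below are inductions with this step. *)
Lemma same_jet_step (K : nat) (f g f' g' : R -> R) :
  f 0 = g 0 ->
  locally 0 (fun t => is_derive f t (f' t)) -> locally 0 (fun t => is_derive g t (g' t)) ->
  same_jet K f' g' -> same_jet (S K) f g.
Proof.
  intros E Df Dg H [|k] Hk; [exact E|]; rewrite !Derive_n_S.
  rewrite (Derive_n_ext_loc (Derive f) f'), (Derive_n_ext_loc (Derive g) g').
  - apply H; lia.
  - revert Dg; apply filter_imp; intros; now apply is_derive_unique.
  - revert Df; apply filter_imp; intros; now apply is_derive_unique.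
Qed.

Lemma Derive_n_plus_smooth (f g : R -> R) (k : nat) (t : R) :
  smooth1_near f t -> smooth1_near g t ->
  Derive_n (fun z => f z + g z) k t = Derive_n f k t + Derive_n g k t.
Proof.
  intros Hf Hg; apply Derive_n_plus;
    [refine (filter_imp _ _ _ Hf)|refine (filter_imp _ _ _ Hg)]; intros z H j _; apply H.
Qed.

Lemma same_jet_plus (K : nat) (f1 f2 g1 g2 : R -> R) :
  smooth1_near f1 0 -> smooth1_near f2 0 -> smooth1_near g1 0 -> smooth1_near g2 0 ->
  same_jet K f1 f2 -> same_jet K g1 g2 ->
  same_jet K (fun t => f1 t + g1 t) (fun t => f2 t + g2 t).
Proof.
  intros Hf1 Hf2 Hg1 Hg2 Jf Jg k Hk.
  rewrite !Derive_n_plus_smooth by assumption; now rewrite Jf, Jg.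
Qed.

Lemma locally_is_derive_mult (f g : R -> R) (t : R) :
  smooth1_near f t -> smooth1_near g t ->
  locally t (fun z => is_derive (fun z => f z * g z) z (Derive f z * g z + f z * Derive g z)).
Proof.
  intros Hf Hg.
  generalize (filter_and _ _ (smooth1_near_open _ _ Hf) (smooth1_near_open _ _ Hg)).
  apply filter_imp; intros z [].
  apply (is_derive_mult f g z (Derive f z) (Derive g z));
    auto using smooth1_near_is_derive; intros; apply Rmult_comm.
Qed.

Lemma same_jet_mult (K : nat) (f1 f2 g1 g2 : R -> R) :
  smooth1_near f1 0 -> smooth1_near f2 0 -> smooth1_near g1 0 -> smooth1_near g2 0 ->
  same_jet K f1 f2 -> same_jet K g1 g2 ->
  same_jet K (fun t => f1 t * g1 t) (fun t => f2 t * g2 t).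
Proof.
  revert f1 f2 g1 g2; induction K as [|K IH]; intros f1 f2 g1 g2 Hf1 Hf2 Hg1 Hg2 Jf Jg.
  - intros k Hk; replace k with 0%nat by lia; simpl.
    f_equal; [apply (Jf 0%nat)|apply (Jg 0%nat)]; lia.
  - eapply same_jet_step; try now apply locally_is_derive_mult.
    + f_equal; [apply (Jf 0%nat)|apply (Jg 0%nat)]; lia.
    + apply same_jet_plus; auto using smooth1_near_mult, smooth1_near_Derive.
      * apply IH; auto using smooth1_near_Derive, same_jet_Derive.
        revert Jg; apply same_jet_le; lia.
      * apply IH; auto using smooth1_near_Derive, same_jet_Derive.
        revert Jf; apply same_jet_le; lia.
Qed.

Lemma same_jet_rsqrt (K : nat) (f g : R -> R) :
  smooth1_near f 0 -> smooth1_near g 0 -> 0 < f 0 -> same_jet K f g ->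
  same_jet K (fun t => / sqrt (f t)) (fun t => / sqrt (g t)).
Proof.
  intros Hf Hg P; revert K.
  assert (E : forall K, same_jet K f g -> f 0 = g 0).
  { intros K J; apply (J 0%nat); lia. }
  induction K as [|K IH]; intros J.
  - intros k Hk; replace k with 0%nat by lia; simpl; now rewrite (E _ J).
  - assert (P' : 0 < g 0) by now rewrite <- (E _ J).
    assert (IH' := IH (same_jet_le _ _ _ _ (Nat.le_succ_diag_r K) J)).
    eapply same_jet_step; [now rewrite (E _ J)|now apply locally_is_derive_rsqrt ..|].
    repeat apply same_jet_mult;
      auto 7 using smooth1_near_mult, smooth1_near_const, smooth1_near_Derive,
        smooth1_near_rsqrt, same_jet_refl, same_jet_Derive.
Qed.

Lemma sqrt_eq_mult_rsqrt (x : R) : 0 < x -> x * / sqrt x = sqrt x.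
Proof.
  intros H; assert (S := sqrt_lt_R0 _ H).
  rewrite <- (sqrt_sqrt x) at 1 by lra; field; lra.
Qed.

Lemma locally_sqrt_eq (f : R -> R) (t : R) :
  smooth1_near f t -> 0 < f t -> locally t (fun z => f z * / sqrt (f z) = sqrt (f z)).
Proof.
  intros H P; generalize (locally_pos f t (smooth1_near_continuous _ _ H) P).
  apply filter_imp; intros z; apply sqrt_eq_mult_rsqrt.
Qed.

Lemma smooth1_near_sqrt (f : R -> R) (t : R) :
  smooth1_near f t -> 0 < f t -> smooth1_near (fun z => sqrt (f z)) t.
Proof.
  intros H P; apply smooth1_near_ext_loc with (1 := locally_sqrt_eq f t H P).
  apply smooth1_near_mult; auto using smooth1_near_rsqrt.
Qed.

(** Reduced to the inverse square root by [sqrt f = f / sqrt f]. *)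
Lemma same_jet_sqrt (K : nat) (f g : R -> R) :
  smooth1_near f 0 -> smooth1_near g 0 -> 0 < f 0 -> same_jet K f g ->
  same_jet K (fun t => sqrt (f t)) (fun t => sqrt (g t)).
Proof.
  intros Hf Hg P J.
  assert (P' : 0 < g 0) by (replace (g 0) with (f 0); [exact P|apply (J 0%nat); lia]).
  apply same_jet_trans with (fun t => f t * / sqrt (f t));
    [apply same_jet_sym, same_jet_ext_loc; now apply locally_sqrt_eq|].
  apply same_jet_trans with (fun t => g t * / sqrt (g t));
    [|apply same_jet_ext_loc; now apply locally_sqrt_eq].
  apply same_jet_mult; auto using smooth1_near_rsqrt, same_jet_rsqrt.
Qed.

(** * Homogeneous polynomials in the divided-power basis *)

Lemma sum_n_S_l {G : AbelianMonoid} (a : nat -> G) (n : nat) :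
  sum_n a (S n) = plus (a 0%nat) (sum_n (fun k => a (S k)) n).
Proof. unfold sum_n; rewrite sum_Sn_m by lia; f_equal; symmetry; apply sum_n_m_S. Qed.

(* Lemmas on iterated sums produce equations whose type is only convertible to
   [R], which [ring] does not recognize. *)
Ltac ring_R := match goal with |- ?a = ?b => change (@eq R a b) end; ring.

Lemma sum_n_Rplus (u v : nat -> R) (n : nat) :
  sum_n (fun k => u k + v k) n = sum_n u n + sum_n v n.
Proof. exact (sum_n_plus u v n). Qed.

Lemma sum_n_Rmult_l (c : R) (u : nat -> R) (n : nat) :
  sum_n (fun k => c * u k) n = c * sum_n u n.
Proof. exact (sum_n_mult_l (K := R_Ring) c u n). Qed.

(** In the basis of divided powers differentiation shifts coefficients without
    numerical factors, and Taylor coefficients are plain derivatives. *)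
Definition divpow (k : nat) (x : R) : R := x ^ k / INR (fact k).

Definition hpoly (d : nat) (c : nat -> R) (x y : R) : R :=
  sum_n (fun a => c a * (divpow a x * divpow (d - a) y)) d.

Lemma hpoly_ext (d : nat) (c c' : nat -> R) :
  (forall a, (a <= d)%nat -> c a = c' a) -> hpoly d c = hpoly d c'.
Proof.
  intros H; apply functional_extensionality; intros x; apply functional_extensionality; intros y.
  apply sum_n_ext_loc; intros a Ha; now rewrite H.
Qed.

Lemma is_derive_divpow (k : nat) (x : R) :
  is_derive (divpow (S k)) x (divpow k x).
Proof.
  unfold divpow; auto_derive; [easy|].
  change (fact k + k * fact k)%nat with (S k * fact k)%nat; rewrite mult_INR.
  change (match k with O => 1 | S _ => INR k + 1 end) with (INR (S k)).
  simpl Nat.pred; field; split; [apply INR_fact_neq_0|apply not_0_INR; lia].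
Qed.

Lemma divpow_0 (x : R) : divpow 0 x = 1.
Proof. unfold divpow; simpl; field. Qed.

Lemma divpow_S (k : nat) (x : R) : INR (S k) * divpow (S k) x = x * divpow k x.
Proof.
  unfold divpow; rewrite fact_simpl, mult_INR; simpl pow.
  field; split; [apply INR_fact_neq_0|apply not_0_INR; lia].
Qed.

Lemma hpoly_0 (c : nat -> R) (x y : R) : hpoly 0 c x y = c 0%nat.
Proof. unfold hpoly; rewrite sum_O, !divpow_0; ring. Qed.

Lemma is_derive_hpoly_x (d : nat) (c : nat -> R) (x y : R) :
  is_derive (fun z => hpoly (S d) c z y) x (hpoly d (fun a => c (S a)) x y).
Proof.
  unfold hpoly.
  evar_last.
  - apply (is_derive_sum_n (fun a z => c a * (divpow a z * divpow (S d - a) y)) (S d) x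
      (fun a => match a with O => 0 | S b => c (S b) * (divpow b x * divpow (d - b) y) end)).
    intros [|b] _.
    + apply (is_derive_ext (fun _ => c 0%nat * (1 * divpow (S d - 0) y))).
      * intros t; now rewrite divpow_0.
      * apply (is_derive_const (V := R_NormedModule)).
    + apply (is_derive_scal (fun z => divpow (S b) z * divpow (S d - S b) y)).
      evar_last; [apply (is_derive_mult (divpow (S b)) (fun _ => divpow (S d - S b) y) x (divpow b x) 0)|].
      * apply is_derive_divpow.
      * apply (is_derive_const (V := R_NormedModule)).
      * intros; apply Rmult_comm.
      * change (divpow b x * divpow (S d - S b) y + divpow (S b) x * 0 = divpow b x * divpow (d - b) y).
        simpl Nat.sub; ring.
  - rewrite sum_n_S_l; apply Rplus_0_l.
Qed.

Lemma is_derive_hpoly_y (d : nat) (c : nat -> R) (x y : R) :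
  is_derive (fun z => hpoly (S d) c x z) y (hpoly d c x y).
Proof.
  unfold hpoly.
  apply (is_derive_ext (fun z => sum_n (fun a => c a * (divpow a x * divpow (S d - a) z)) d
      + c (S d) * (divpow (S d) x * 1))).
  { intros t; rewrite sum_Sn, Nat.sub_diag, divpow_0; reflexivity. }
  evar_last.
  - apply (is_derive_plus (fun z => sum_n (fun a => c a * (divpow a x * divpow (S d - a) z)) d)
      (fun _ => c (S d) * (divpow (S d) x * 1)) y
      (sum_n (fun a => c a * (divpow a x * divpow (d - a) y)) d) 0).
    2: apply (is_derive_const (V := R_NormedModule)).
    apply (is_derive_sum_n (fun a z => c a * (divpow a x * divpow (S d - a) z)) d y
      (fun a => c a * (divpow a x * divpow (d - a) y))).
    intros a Ha; replace (S d - a)%nat with (S (d - a)) by lia.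
    apply (is_derive_scal (fun z => divpow a x * divpow (S (d - a)) z)).
    apply (is_derive_scal (divpow (S (d - a)))), is_derive_divpow.
  - apply Rplus_0_r.
Qed.

Lemma dx_hpoly (d : nat) (c : nat -> R) : dx (hpoly (S d) c) = hpoly d (fun a => c (S a)).
Proof.
  apply functional_extensionality; intros x; apply functional_extensionality; intros y.
  apply is_derive_unique, is_derive_hpoly_x.
Qed.

Lemma dy_hpoly (d : nat) (c : nat -> R) : dy (hpoly (S d) c) = hpoly d c.
Proof.
  apply functional_extensionality; intros x; apply functional_extensionality; intros y.
  apply is_derive_unique, is_derive_hpoly_y.
Qed.

Lemma dx_hpoly_0 (c : nat -> R) (x y : R) : dx (hpoly 0 c) x y = 0.
Proof.
  unfold dx; rewrite (Derive_ext _ (fun _ => c 0%nat)); [apply Derive_const|].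
  intros; apply hpoly_0.
Qed.

Lemma dy_hpoly_0 (c : nat -> R) (x y : R) : dy (hpoly 0 c) x y = 0.
Proof.
  unfold dy; rewrite (Derive_ext _ (fun _ => c 0%nat)); [apply Derive_const|].
  intros; apply hpoly_0.
Qed.

Lemma continuity_2d_divpow (a b : nat) (x y : R) :
  continuity_2d_pt (fun u v => divpow a u * divpow b v) x y.
Proof.
  assert (P : forall (h : R -> R -> R) k, continuity_2d_pt h x y ->
    continuity_2d_pt (fun u v => divpow k (h u v)) x y).
  { intros h k H; unfold divpow, Rdiv; apply continuity_2d_pt_mult; [|apply continuity_2d_pt_const].
    induction k as [|k IH]; simpl; [apply continuity_2d_pt_const|now apply continuity_2d_pt_mult]. }
  apply continuity_2d_pt_mult.
  - apply (P (fun u _ => u)), continuity_2d_pt_id1.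
  - apply (P (fun _ v => v)), continuity_2d_pt_id2.
Qed.

Lemma continuity_2d_hpoly (d : nat) (c : nat -> R) (x y : R) :
  continuity_2d_pt (hpoly d c) x y.
Proof.
  unfold hpoly; generalize d at 2; intros n; induction n as [|n IH].
  - apply continuity_2d_pt_ext_loc with (fun u v => c 0%nat * (divpow 0 u * divpow (d - 0) v)).
    + apply locally_2d_forall; intros; now rewrite sum_O.
    + apply continuity_2d_pt_mult; [apply continuity_2d_pt_const|apply continuity_2d_divpow].
  - apply continuity_2d_pt_ext_loc with (fun u v =>
      sum_n (fun a => c a * (divpow a u * divpow (d - a) v)) n
      + c (S n) * (divpow (S n) u * divpow (d - S n) v)).
    + apply locally_2d_forall; intros; now rewrite sum_Sn.
    + apply continuity_2d_pt_plus; [exact IH|].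
      apply continuity_2d_pt_mult; [apply continuity_2d_pt_const|apply continuity_2d_divpow].
Qed.

Lemma smooth2_near_hpoly (d : nat) (c : nat -> R) (x y : R) :
  smooth2_near (hpoly d c) x y.
Proof.
  apply (smooth2_of_closed (fun w => exists d c, w = hpoly d c)); [|now exists d, c].
  clear; intros w (d & c & ->).
  destruct d as [|d].
  - exists (hpoly 0 (fun _ => 0)), (hpoly 0 (fun _ => 0)).
    split; [now exists 0%nat, (fun _ => 0)|]; split; [now exists 0%nat, (fun _ => 0)|].
    intros x y; rewrite hpoly_0; split; [apply continuity_2d_hpoly|].
    split; (apply (is_derive_ext (fun _ => c 0%nat));
      [intros; symmetry; apply hpoly_0|apply (is_derive_const (V := R_NormedModule))]).
  - exists (hpoly d (fun a => c (S a))), (hpoly d c).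
    split; [now exists d, (fun a => c (S a))|]; split; [now exists d, c|].
    intros x y; split; [apply continuity_2d_hpoly|].
    split; [apply is_derive_hpoly_x|apply is_derive_hpoly_y].
Qed.

(** Euler's identity for homogeneous functions. *)
Lemma hpoly_euler (d : nat) (c : nat -> R) (x y : R) :
  x * hpoly d (fun a => c (S a)) x y + y * hpoly d c x y = INR (S d) * hpoly (S d) c x y.
Proof.
  unfold hpoly; rewrite <- !sum_n_Rmult_l.
  transitivity (sum_n (fun k => c k * (INR k * divpow k x * divpow (S d - k) y)
    + c k * (divpow k x * (INR (S d - k) * divpow (S d - k) y))) (S d)).
  2: { apply sum_n_ext_loc; intros k Hk; rewrite minus_INR by lia; ring_R. }
  rewrite sum_n_Rplus; f_equal.
  - rewrite sum_n_S_l; simpl (INR 0); rewrite !Rmult_0_l, Rmult_0_r.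
    transitivity (0 + sum_n (fun a => x * (c (S a) * (divpow a x * divpow (d - a) y))) d);
      [symmetry; apply Rplus_0_l|apply f_equal].
    apply sum_n_ext; intros a; rewrite divpow_S; simpl Nat.sub; ring_R.
  - rewrite sum_Sn, Nat.sub_diag; simpl (INR 0); rewrite !Rmult_0_l, !Rmult_0_r.
    transitivity (sum_n (fun a => y * (c a * (divpow a x * divpow (d - a) y))) d + 0);
      [symmetry; apply Rplus_0_r|change plus with Rplus; apply (f_equal (fun z => z + 0))].
    apply sum_n_ext_loc; intros a Ha; replace (S d - a)%nat with (S (d - a)) by lia.
    rewrite divpow_S; ring_R.
Qed.

(** * Taylor polynomials and jets of functions of two variables *)

Definition taylor (K : nat) (c : nat -> nat -> R) (x y : R) : R :=
  sum_n (fun d => hpoly d (fun a => c a (d - a)%nat) x y) K.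

Lemma taylor_S (K : nat) (c : nat -> nat -> R) :
  taylor (S K) c = fun x y => taylor K c x y + 1 * hpoly (S K) (fun a => c a (S K - a)%nat) x y.
Proof.
  apply functional_extensionality; intros x; apply functional_extensionality; intros y.
  unfold taylor; rewrite sum_Sn, Rmult_1_l; reflexivity.
Qed.

Lemma taylor_0 (c : nat -> nat -> R) : taylor 0 c = hpoly 0 (fun a => c a (0 - a)%nat).
Proof.
  apply functional_extensionality; intros x; apply functional_extensionality; intros y.
  unfold taylor; now rewrite sum_O.
Qed.

Lemma smooth2_near_taylor (K : nat) (c : nat -> nat -> R) (x y : R) :
  smooth2_near (taylor K c) x y.
Proof.
  induction K as [|K IH].
  - rewrite taylor_0; apply smooth2_near_hpoly.
  - rewrite taylor_S; apply smooth2_near_axpy; [exact IH|apply smooth2_near_hpoly].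
Qed.

Lemma dx_taylor (K : nat) (c : nat -> nat -> R) :
  dx (taylor (S K) c) = taylor K (fun a b => c (S a) b).
Proof.
  apply functional_extensionality; intros x; apply functional_extensionality; intros y.
  induction K as [|K IH]; rewrite taylor_S, dx_axpy by
    (try apply smooth2_near_taylor; apply smooth2_near_hpoly); rewrite dx_hpoly.
  - rewrite !taylor_0, dx_hpoly_0; simpl; ring.
  - now rewrite IH, (taylor_S K).
Qed.

Lemma dy_taylor (K : nat) (c : nat -> nat -> R) :
  dy (taylor (S K) c) = taylor K (fun a b => c a (S b)).
Proof.
  apply functional_extensionality; intros x; apply functional_extensionality; intros y.
  assert (E : forall d, hpoly d (fun a => c a (S d - a)%nat) = hpoly d (fun a => c a (S (d - a)))).
  { intros d; apply hpoly_ext; intros a Ha; f_equal; lia. }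
  induction K as [|K IH]; rewrite taylor_S, dy_axpy by
    (try apply smooth2_near_taylor; apply smooth2_near_hpoly); rewrite dy_hpoly, E.
  - rewrite !taylor_0, dy_hpoly_0; simpl; ring.
  - now rewrite IH, (taylor_S K).
Qed.

(** Agreement of two jets, possibly at different points.  The recursion lets the
    mixed derivatives appear in every order, as the chain rule produces them. *)
Fixpoint same_jet2 (K : nat) (v w : R -> R -> R) (x y x' y' : R) : Prop :=
  v x y = w x' y' /\
  match K with
  | O => True
  | S L => same_jet2 L (dx v) (dx w) x y x' y' /\ same_jet2 L (dy v) (dy w) x y x' y'
  end.

Lemma same_jet2_refl (K : nat) (v : R -> R -> R) (x y : R) : same_jet2 K v v x y x y.
Proof. revert v; induction K; intros v; simpl; auto. Qed.

Lemma same_jet2_value (K : nat) (v w : R -> R -> R) (x y x' y' : R) :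
  same_jet2 K v w x y x' y' -> v x y = w x' y'.
Proof. destruct K; now intros []. Qed.

Lemma hpoly_origin (d : nat) (c : nat -> R) : hpoly (S d) c 0 0 = 0.
Proof.
  assert (H := hpoly_euler d c 0 0); rewrite !Rmult_0_l, Rplus_0_r in H.
  apply eq_sym, Rmult_integral in H; destruct H as [H|H]; [|exact H].
  exfalso; revert H; apply not_0_INR; lia.
Qed.

Lemma taylor_origin (K : nat) (c : nat -> nat -> R) : taylor K c 0 0 = c 0%nat 0%nat.
Proof.
  induction K as [|K IH]; [now rewrite taylor_0, hpoly_0|].
  rewrite taylor_S, IH, hpoly_origin; ring.
Qed.

Lemma taylor_ext (K : nat) (c c' : nat -> nat -> R) :
  (forall a b, (a + b <= K)%nat -> c a b = c' a b) -> taylor K c = taylor K c'.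
Proof.
  intros H; apply functional_extensionality; intros x; apply functional_extensionality; intros y.
  apply sum_n_ext_loc; intros d Hd; rewrite (hpoly_ext d _ (fun a => c' a (d - a)%nat)); auto.
  intros a Ha; apply H; lia.
Qed.

Lemma same_jet2_taylor (K : nat) (w : R -> R -> R) (x y : R) :
  smooth2_near w x y ->
  same_jet2 K w (taylor K (fun m n => partial_derive m n w x y)) x y 0 0.
Proof.
  revert w; induction K as [|K IH]; intros w H; (split; [now rewrite taylor_origin|]); [easy|].
  rewrite dx_taylor, dy_taylor; split.
  - rewrite (taylor_ext K _ (fun m n => partial_derive m n (dx w) x y)).
    + now apply IH, smooth2_near_dx.
    + intros a b _; symmetry; now apply partial_derive_dx.
  - rewrite (taylor_ext K _ (fun m n => partial_derive m n (dy w) x y)).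
    + now apply IH, smooth2_near_dy.
    + intros a b _; symmetry; now apply partial_derive_dy.
Qed.

(** By the chain rule, derivatives of the composition are built from lower
    derivatives of the constituents.  The two curves may have different origins,
    which compares a function near a point with its Taylor polynomial near the
    origin. *)
Lemma same_jet_comp (K : nat) (v w : R -> R -> R) (r1 s1 r2 s2 : R -> R) :
  smooth2_near v (r1 0) (s1 0) -> smooth2_near w (r2 0) (s2 0) ->
  smooth1_near r1 0 -> smooth1_near s1 0 -> smooth1_near r2 0 -> smooth1_near s2 0 ->
  same_jet2 K v w (r1 0) (s1 0) (r2 0) (s2 0) ->
  (forall k, (k < K)%nat -> Derive_n (Derive r1) k 0 = Derive_n (Derive r2) k 0 /\
     Derive_n (Derive s1) k 0 = Derive_n (Derive s2) k 0) ->
  same_jet K (fun t => v (r1 t) (s1 t)) (fun t => w (r2 t) (s2 t)).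
Proof.
  revert v w; induction K as [|K IH]; intros v w Hv Hw Hr1 Hs1 Hr2 Hs2 J D.
  - intros k Hk; replace k with 0%nat by lia; exact (same_jet2_value _ _ _ _ _ _ _ J).
  - destruct J as (E & Jx & Jy).
    eapply same_jet_step; [exact E|now apply locally_is_derive_comp_2d ..|].
    assert (D' : forall k, (k < K)%nat -> Derive_n (Derive r1) k 0 = Derive_n (Derive r2) k 0 /\
      Derive_n (Derive s1) k 0 = Derive_n (Derive s2) k 0) by (intros; apply D; lia).
    assert (Dr : same_jet K (Derive r1) (Derive r2)) by (intros k Hk; apply D; lia).
    assert (Ds : same_jet K (Derive s1) (Derive s2)) by (intros k Hk; apply D; lia).
    assert (S1 := fun u Hu => smooth1_near_comp u r1 s1 0 Hu Hr1 Hs1).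
    assert (S2 := fun u Hu => smooth1_near_comp u r2 s2 0 Hu Hr2 Hs2).
    assert (X1 := S1 _ (smooth2_near_dx _ _ _ Hv)); assert (Y1 := S1 _ (smooth2_near_dy _ _ _ Hv)).
    assert (X2 := S2 _ (smooth2_near_dx _ _ _ Hw)); assert (Y2 := S2 _ (smooth2_near_dy _ _ _ Hw)).
    assert (R1 := smooth1_near_Derive _ _ Hr1); assert (R2 := smooth1_near_Derive _ _ Hr2).
    assert (T1 := smooth1_near_Derive _ _ Hs1); assert (T2 := smooth1_near_Derive _ _ Hs2).
    apply same_jet_plus.
    + exact (smooth1_near_mult _ _ _ X1 R1).
    + exact (smooth1_near_mult _ _ _ X2 R2).
    + exact (smooth1_near_mult _ _ _ Y1 T1).
    + exact (smooth1_near_mult _ _ _ Y2 T2).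
    + refine (same_jet_mult K _ _ _ _ X1 X2 R1 R2 _ Dr); apply IH; auto using smooth2_near_dx.
    + refine (same_jet_mult K _ _ _ _ Y1 Y2 T1 T2 _ Ds); apply IH; auto using smooth2_near_dy.
Qed.

(** * The polynomials [Gpoly] and [Hpoly] in the divided-power basis *)

(** The real part of [i ^ a]. *)
Fixpoint alt (a : nat) : R :=
  match a with O => 1 | 1%nat => 0 | S (S b) => - alt b end.

(** Coefficients of [Gpoly m n] and [Hpoly m n] in the divided-power basis; they
    do not depend on [n], only the degree does. *)
Definition Gcoef (m a : nat) : R := if (m <=? a)%nat then alt (a - m) else 0.
Definition Hcoef (m a : nat) : R := if (m <? a)%nat then alt (a - m) else 0.

Lemma sum_n_shift (h F : nat -> R) (m n : nat) :
  sum_n (fun a => (if (m <=? a)%nat then h (a - m)%nat else 0) * F a) (m + n) =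
  sum_n (fun b => h b * F (m + b)%nat) n.
Proof.
  revert F; induction m as [|m IH]; intros F; simpl Nat.add.
  - apply sum_n_ext; intros b; now rewrite Nat.sub_0_r.
  - rewrite sum_n_S_l; simpl Nat.leb; rewrite Rmult_0_l, <- (IH (fun a => F (S a))).
    apply Rplus_0_l.
Qed.

Lemma sum_n_alt (F : nat -> R) (n : nat) :
  sum_n (fun b => alt b * F b) n = sum_n (fun l => (-1) ^ l * F (2 * l)%nat) (n / 2).
Proof.
  revert F; induction n as [n IH] using lt_wf_ind; intros F.
  destruct n as [|[|n]].
  - rewrite !sum_O; simpl; ring_R.
  - rewrite sum_Sn, !sum_O; simpl; change plus with Rplus; ring_R.
  - replace (S (S n) / 2)%nat with (S (n / 2)).
    2: { replace (S (S n)) with (n + 1 * 2)%nat by lia; rewrite Nat.div_add; lia. }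
    rewrite !sum_n_S_l; change plus with Rplus; simpl (alt 0); simpl (alt 1).
    rewrite (sum_n_ext _ (fun b => -1 * (alt b * F (S (S b))))) by (intros; simpl; ring_R).
    rewrite (sum_n_ext (fun k => (-1) ^ S k * F (2 * S k)%nat)
      (fun l => -1 * ((-1) ^ l * F (S (S (2 * l)))%nat))).
    2: { intros l; replace (2 * S l)%nat with (S (S (2 * l))) by lia; simpl; ring_R. }
    rewrite !sum_n_Rmult_l, (IH n ltac:(lia) (fun b => F (S (S b)))); simpl; ring_R.
Qed.

Lemma sum_n_first (u : nat -> R) (n : nat) :
  sum_n u (S n) = u 0%nat + sum_n_m u 1 (S n).
Proof. unfold sum_n; now rewrite sum_Sn_m by lia. Qed.

Lemma Gpoly_hpoly (m n : nat) : Gpoly m n = hpoly (m + n) (Gcoef m).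
Proof.
  apply functional_extensionality; intros x; apply functional_extensionality; intros y.
  unfold Gpoly, hpoly, Gcoef.
  rewrite (sum_n_shift alt (fun a => divpow a x * divpow (m + n - a) y)), sum_n_alt.
  apply sum_n_ext; intros l; replace (m + n - (m + 2 * l))%nat with (n - 2 * l)%nat by lia.
  unfold divpow; match goal with |- ?a = ?b => change (@eq R a b) end.
  field; split; apply INR_fact_neq_0.
Qed.

Lemma Hpoly_hpoly (m n : nat) : Hpoly m n = hpoly (m + (n + 2)) (Hcoef m).
Proof.
  apply functional_extensionality; intros x; apply functional_extensionality; intros y.
  unfold Hpoly, hpoly.
  set (F a := divpow a x * divpow (m + (n + 2) - a) y).
  (* The term of index [m], which [Hcoef] leaves out, is the one at [l = 0]. *)
  assert (E : sum_n (fun a => Hcoef m a * F a) (m + (n + 2)) + F m =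
              sum_n (fun l => (-1) ^ l * F (m + 2 * l)%nat) (S (n / 2))).
  { transitivity (sum_n (fun a => Gcoef m a * F a) (m + (n + 2))).
    - unfold Gcoef; rewrite (sum_n_shift alt F).
      rewrite (sum_n_ext (fun a => Hcoef m a * F a)
        (fun a => (if (m <=? a)%nat then (if (a - m =? 0)%nat then 0 else alt (a - m)) else 0) * F a)).
      + rewrite (sum_n_shift (fun b => if (b =? 0)%nat then 0 else alt b) F).
        replace (n + 2)%nat with (S (S n)) by lia.
        rewrite !(sum_n_S_l _ (S n)); simpl; rewrite Nat.add_0_r; change plus with Rplus; ring_R.
      + intros a; unfold Hcoef; destruct (Nat.ltb_spec m a), (Nat.leb_spec m a),
          (Nat.eqb_spec (a - m) 0); try lia; reflexivity.
    - unfold Gcoef; rewrite (sum_n_shift alt F), sum_n_alt; f_equal.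
      replace (n + 2)%nat with (n + 1 * 2)%nat by lia; rewrite Nat.div_add; lia. }
  rewrite sum_n_first, Nat.mul_0_r, Nat.add_0_r in E; simpl pow in E.
  transitivity (sum_n_m (fun l => (-1) ^ l * F (m + 2 * l)%nat) 1 (S (n / 2))).
  2: { apply (Rplus_eq_reg_r (F m)); symmetry; etransitivity; [exact E|ring]. }
  apply sum_n_m_ext; intros l; unfold F.
  replace (m + (n + 2) - (m + 2 * l))%nat with (n + 2 - 2 * l)%nat by lia.
  unfold divpow; match goal with |- ?a = ?b => change (@eq R a b) end.
  field; split; apply INR_fact_neq_0.
Qed.

(** With [Gcoef_1_S], the Cauchy-Riemann equations for [Gpoly 0 (n + 1)] and
    [Gpoly 1 n], read on coefficients. *)
Lemma Gcoef_0_S (a : nat) : Gcoef 0 (S a) = - Gcoef 1 a.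
Proof. unfold Gcoef; destruct a; simpl; rewrite ?Nat.sub_0_r; ring. Qed.

Lemma Gcoef_1_S (a : nat) : Gcoef 1 (S a) = Gcoef 0 a.
Proof. unfold Gcoef; simpl; now rewrite Nat.sub_0_r. Qed.

(** Read on coefficients: the Laplacian of [Hpoly m n] is minus the divided-power
    monomial of bidegree [(m, n)]. *)
Lemma Hcoef_SS (m a : nat) :
  Hcoef m (S (S a)) = - Hcoef m a - (if (m =? a)%nat then 1 else 0).
Proof.
  unfold Hcoef; destruct (Nat.ltb_spec m a), (Nat.ltb_spec m (S (S a))), (Nat.eqb_spec m a);
    try lia; try ring.
  - replace (S (S a) - m)%nat with (S (S (a - m))) by lia; simpl; ring.
  - replace (S (S a) - m)%nat with 2%nat by lia; simpl; ring.
  - replace (S (S a) - m)%nat with 1%nat by lia; simpl; ring.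
Qed.

(** * Linear functionals of the coefficients *)

(** The Taylor coefficient of order [p] of a homogeneous polynomial along the
    curve, or of its conormal derivative, depends in this way on the
    coefficients of the polynomial; this is all that the elimination uses. *)
Definition linear_upto (d : nat) (L : (nat -> R) -> R) : Prop :=
  (forall c c' k, L (fun a => c a + k * c' a) = L c + k * L c') /\
  (forall c c', (forall a, (a <= d)%nat -> c a = c' a) -> L c = L c').

Lemma linear_upto_zero (d : nat) (L : (nat -> R) -> R) :
  linear_upto d L -> L (fun _ => 0) = 0.
Proof.
  intros [Lin Ext]; assert (H := Lin (fun _ => 0) (fun _ => 0) 1); cbv beta in H.
  rewrite (Ext (fun _ => 0 + 1 * 0) (fun _ => 0)) in H by (intros; ring); lra.
Qed.

Lemma linear_upto_sum (d : nat) (L : (nat -> R) -> R) (k : nat -> R) (c : nat -> nat -> R) (N : nat) :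
  linear_upto d L ->
  L (fun a => sum_n (fun m => k m * c m a) N) = sum_n (fun m => k m * L (c m)) N.
Proof.
  intros HL; assert (Z := linear_upto_zero d L HL); destruct HL as [Lin Ext].
  induction N as [|N IH].
  - rewrite sum_O, (Ext _ (fun a => 0 + k 0%nat * c 0%nat a)).
    + rewrite Lin, Z; ring_R.
    + intros; rewrite sum_O; ring_R.
  - rewrite sum_Sn, <- IH.
    rewrite (Ext _ (fun a => sum_n (fun m => k m * c m a) N + k (S N) * c (S N) a)).
    + apply Lin.
    + intros; now rewrite sum_Sn.
Qed.

Definition delta (m a : nat) : R := if (m =? a)%nat then 1 else 0.

Lemma sum_n_delta (k : nat -> R) (a N : nat) :
  sum_n (fun m => k m * delta m a) N = if (a <=? N)%nat then k a else 0.
Proof.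
  induction N as [|N IH].
  - rewrite sum_O; unfold delta; destruct a; simpl; ring_R.
  - rewrite sum_Sn, IH; change plus with Rplus; unfold delta.
    destruct (Nat.leb_spec a N), (Nat.leb_spec a (S N)), (Nat.eqb_spec (S N) a);
      subst; try lia; ring_R.
Qed.

Lemma linear_upto_delta (d : nat) (L : (nat -> R) -> R) (c : nat -> R) :
  linear_upto d L -> L c = sum_n (fun m => c m * L (delta m)) d.
Proof.
  intros HL; rewrite <- (linear_upto_sum d L c delta d HL); apply HL.
  intros a Ha; rewrite sum_n_delta; now destruct (Nat.leb_spec a d); [|lia].
Qed.

Lemma hpoly_axpy (d : nat) (c c' : nat -> R) (k x y : R) :
  hpoly d (fun a => c a + k * c' a) x y = hpoly d c x y + k * hpoly d c' x y.
Proof.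
  unfold hpoly; rewrite <- sum_n_Rmult_l, <- sum_n_Rplus.
  apply sum_n_ext; intros; ring_R.
Qed.

Lemma hpoly_delta (d m : nat) (x y : R) :
  (m <= d)%nat -> hpoly d (delta m) x y = divpow m x * divpow (d - m) y.
Proof.
  intros H; unfold hpoly.
  rewrite (sum_n_ext _ (fun a => (divpow a x * divpow (d - a) y) * delta a m)).
  - rewrite sum_n_delta; now destruct (Nat.leb_spec m d); [|lia].
  - intros a; unfold delta; rewrite (Nat.eqb_sym m a); ring_R.
Qed.

(** * Taylor coefficients along the curve *)

Lemma sum_Lambda_degree {G : AbelianMonoid} (K : nat) (a : nat -> nat -> G) :
  sum_Lambda K a = sum_n (fun d => sum_n (fun i => a i (d - i)%nat) d) K.
Proof.
  induction K as [|K IH].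
  - unfold sum_Lambda; now rewrite !sum_O.
  - rewrite sum_Sn, <- IH; unfold sum_Lambda.
    rewrite !sum_Sn, Nat.sub_diag, sum_O.
    rewrite plus_assoc, <- sum_n_plus; f_equal.
    apply sum_n_ext_loc; intros m Hm.
    replace (S K - m)%nat with (S (K - m)) by lia; now rewrite sum_Sn.
Qed.

Lemma tcoef_axpy (f g : R -> R) (k : R) (p : nat) :
  smooth1_near f 0 -> smooth1_near g 0 ->
  tcoef (fun t => f t + k * g t) p = tcoef f p + k * tcoef g p.
Proof.
  intros Hf Hg; unfold tcoef.
  rewrite Derive_n_plus_smooth, Derive_n_scal_l.
  - unfold Rdiv; ring.
  - exact Hf.
  - apply smooth1_near_mult; [apply smooth1_near_const|exact Hg].
Qed.

Lemma tcoef_ext (f g : R -> R) (p : nat) : (forall t, f t = g t) -> tcoef f p = tcoef g p.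
Proof. intros H; unfold tcoef; f_equal; now apply Derive_n_ext. Qed.

Lemma tcoef_ext_loc (f g : R -> R) (p : nat) :
  locally 0 (fun t => f t = g t) -> tcoef f p = tcoef g p.
Proof. intros H; unfold tcoef; f_equal; now apply Derive_n_ext_loc. Qed.

Lemma same_jet_tcoef (K : nat) (f g : R -> R) (p : nat) :
  same_jet K f g -> (p <= K)%nat -> tcoef f p = tcoef g p.
Proof. intros H Hp; unfold tcoef; now rewrite H. Qed.

Lemma along_conormal_axpy (r s : R -> R) (v w : R -> R -> R) (k t : R) :
  smooth2_near v (r t) (s t) -> smooth2_near w (r t) (s t) ->
  along_conormal r s (fun x y => v x y + k * w x y) t =
  along_conormal r s v t + k * along_conormal r s w t.
Proof.
  intros Hv Hw; unfold along_conormal; rewrite dx_axpy, dy_axpy by assumption; ring.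
Qed.

Lemma along_conormal_hpoly_S (r s : R -> R) (d : nat) (c : nat -> R) (t : R) :
  along_conormal r s (hpoly (S d) c) t =
  hpoly d (fun a => c (S a)) (r t) (s t) * Derive s t +
  hpoly d c (r t) (s t) * (-1 * Derive r t).
Proof. unfold along_conormal; rewrite dx_hpoly, dy_hpoly; ring. Qed.

Section AlongCurve.

Variables r s : R -> R.
Hypotheses (Hr : smooth1_near r 0) (Hs : smooth1_near s 0).

Lemma smooth1_near_conormal (w : R -> R -> R) :
  smooth2_near w (r 0) (s 0) -> smooth1_near (along_conormal r s w) 0.
Proof using Hr Hs.
  intros H; unfold along_conormal.
  apply smooth1_near_ext_loc with (fun t => dx w (r t) (s t) * Derive s t
    + dy w (r t) (s t) * (-1 * Derive r t)).
  { apply filter_forall; intros t; ring. }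
  apply smooth1_near_plus; apply smooth1_near_mult.
  - apply (smooth1_near_comp (dx w)); auto using smooth2_near_dx.
  - exact (smooth1_near_Derive _ _ Hs).
  - apply (smooth1_near_comp (dy w)); auto using smooth2_near_dy.
  - exact (smooth1_near_mult _ _ _ (smooth1_near_const _ _) (smooth1_near_Derive _ _ Hr)).
Qed.

Definition curve_coef (W : R -> R) (p : nat) (w : R -> R -> R) : R :=
  tcoef (fun t => w (r t) (s t) * W t) p.
Definition conormal_coef (p : nat) (w : R -> R -> R) : R :=
  tcoef (along_conormal r s w) p.

(** Common abstraction of [curve_coef] and [conormal_coef], so that the
    elimination is carried out once for the jumps of the value and of the
    normal derivative. *)
Definition linear_functional (L : (R -> R -> R) -> R) : Prop :=
  forall v w k, (forall x y, smooth2_near v x y) -> (forall x y, smooth2_near w x y) ->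
    L (fun x y => v x y + k * w x y) = L v + k * L w.

Lemma linear_curve_coef (W : R -> R) (p : nat) :
  smooth1_near W 0 -> linear_functional (curve_coef W p).
Proof using Hr Hs.
  intros HW v w k Hv Hw; unfold curve_coef; rewrite <- tcoef_axpy.
  - apply tcoef_ext; intros; ring.
  - apply smooth1_near_mult; [now apply smooth1_near_comp|exact HW].
  - apply smooth1_near_mult; [now apply smooth1_near_comp|exact HW].
Qed.

Lemma linear_conormal_coef (p : nat) : linear_functional (conormal_coef p).
Proof using Hr Hs.
  intros v w k Hv Hw; unfold conormal_coef; rewrite <- tcoef_axpy.
  - apply tcoef_ext; intros; now apply along_conormal_axpy.
  - now apply smooth1_near_conormal.
  - now apply smooth1_near_conormal.
Qed.

End AlongCurve.

Lemma linear_functional_hpoly (L : (R -> R -> R) -> R) (d : nat) :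
  linear_functional L -> linear_upto d (fun c => L (hpoly d c)).
Proof.
  intros HL; split.
  - intros c c' k; rewrite <- HL by (intros; apply smooth2_near_hpoly); f_equal.
    apply functional_extensionality; intros x; apply functional_extensionality; intros y.
    apply hpoly_axpy.
  - intros c c' H; now rewrite (hpoly_ext d c c').
Qed.

Lemma linear_functional_taylor (L : (R -> R -> R) -> R) (K : nat) (c : nat -> nat -> R) :
  linear_functional L ->
  L (taylor K c) = sum_n (fun d => L (hpoly d (fun a => c a (d - a)%nat))) K.
Proof.
  intros HL; induction K as [|K IH]; [now rewrite taylor_0, sum_O|].
  rewrite taylor_S, HL, IH, sum_Sn by (intros; try apply smooth2_near_taylor; apply smooth2_near_hpoly).
  change plus with Rplus; ring_R.
Qed.

Lemma linear_functional_monomials (L : (R -> R -> R) -> R) (K : nat) (c : nat -> nat -> R) :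
  linear_functional L ->
  L (taylor K c) = sum_Lambda K (fun m n => L (hpoly (m + n) (delta m)) * c m n).
Proof.
  intros HL; rewrite linear_functional_taylor by exact HL; rewrite sum_Lambda_degree.
  apply sum_n_ext; intros d.
  rewrite (linear_upto_delta d _ _ (linear_functional_hpoly L d HL)).
  apply sum_n_ext_loc; intros a Ha; replace (a + (d - a))%nat with d by lia; ring_R.
Qed.

Lemma sum_n_eq_0 (a : nat -> R) (n : nat) : (forall k, a k = 0) -> sum_n a n = 0.
Proof.
  intros H; rewrite (sum_n_ext _ (fun _ => zero)) by exact H.
  exact (sum_n_m_const_zero (G := R_AbelianMonoid) 0 n).
Qed.

(** * Elimination of the pure [x]-derivatives *)

(** The equation trades two [x]-derivatives for two [y]-derivatives and a source
    term, so a two-step induction on [a] reduces every derivative to those with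
    at most one [x]-derivative. *)
Lemma jet_elimination (D F : nat -> nat -> R) (d a : nat) :
  (forall m n, D (S (S m)) n + D m (S (S n)) = F m n) ->
  (a <= S d)%nat ->
  D a (S d - a)%nat = D 0%nat (S d) * Gcoef 0 a + D 1%nat d * Gcoef 1 a
    - match d with
      | O => 0
      | S e => sum_n (fun m => F m (e - m)%nat * Hcoef m a) e
      end.
Proof.
  intros PDE; induction a as [a IH] using lt_wf_ind; intros Ha.
  destruct a as [|[|a]].
  - assert (Z : match d with O => 0
      | S e => sum_n (fun m => F m (e - m)%nat * Hcoef m 0) e end = 0).
    { destruct d as [|e]; [easy|].
      apply sum_n_eq_0; intros m; unfold Hcoef; simpl; ring. }
    rewrite Z, Nat.sub_0_r; unfold Gcoef; simpl; ring.
  - assert (Z : match d with O => 0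
      | S e => sum_n (fun m => F m (e - m)%nat * Hcoef m 1) e end = 0).
    { destruct d as [|e]; [easy|].
      apply sum_n_eq_0; intros [|m]; unfold Hcoef; simpl; ring. }
    rewrite Z; unfold Gcoef; simpl; rewrite Nat.sub_0_r; ring.
  - destruct d as [|e]; [lia|].
    assert (H := IH a ltac:(lia) ltac:(lia)); assert (P := PDE a (e - a)%nat).
    replace (S (S e) - S (S a))%nat with (e - a)%nat by lia.
    replace (S (S e) - a)%nat with (S (S (e - a))) in H by lia.
    rewrite Gcoef_0_S, !Gcoef_1_S, Gcoef_0_S.
    rewrite (sum_n_ext _ (fun m => -1 * (F m (e - m)%nat * Hcoef m a)
      + -1 * (F m (e - m)%nat * delta m a))).
    2: { intros m; rewrite Hcoef_SS; unfold delta; ring_R. }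
    rewrite sum_n_Rplus, !sum_n_Rmult_l, sum_n_delta.
    destruct (Nat.leb_spec a e); [|lia].
    replace (D (S (S a)) (e - a)%nat) with (F a (e - a)%nat - D a (S (S (e - a)))) by lra.
    rewrite H; ring.
Qed.

Lemma linear_functional_elimination (L : (R -> R -> R) -> R) (D F : nat -> nat -> R) (M : nat) :
  (1 <= M)%nat -> linear_functional L ->
  (forall m n, D (S (S m)) n + D m (S (S n)) = F m n) ->
  L (taylor (M + 1) D) =
    D 0%nat 0%nat * L (Gpoly 0 0)
    + sum_n (fun d => D 0%nat (S d) * L (Gpoly 0 (S d)) + D 1%nat d * L (Gpoly 1 d)) M
    - sum_Lambda (M - 1) (fun m n => F m n * L (Hpoly m n)).
Proof.
  intros HM HL PDE; replace (M + 1)%nat with (S M) by lia.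
  assert (Lin := fun d => linear_functional_hpoly L d HL).
  (* The source terms of total degree [d + 1], of which there are none for [d = 0]. *)
  set (E d := match d with O => 0
    | S e => sum_n (fun m => F m (e - m)%nat * L (hpoly (S (S e)) (Hcoef m))) e end).
  rewrite linear_functional_taylor, sum_n_S_l by exact HL.
  rewrite (sum_n_ext _ (fun d => (D 0%nat (S d) * L (Gpoly 0 (S d)) + D 1%nat d * L (Gpoly 1 d))
    + -1 * E d)).
  - rewrite sum_n_Rplus, sum_n_Rmult_l.
    replace (L (hpoly 0 (fun a => D a (0 - a)%nat))) with (D 0%nat 0%nat * L (Gpoly 0 0)).
    2: { rewrite Gpoly_hpoly, (linear_upto_delta 0 _ (fun a => D a (0 - a)%nat) (Lin 0%nat)), sum_O.
         simpl; f_equal; f_equal; now apply hpoly_ext; intros [|a] Ha; [|lia]. }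
    replace (sum_Lambda (M - 1) (fun m n => F m n * L (Hpoly m n))) with (sum_n E M).
    { change plus with Rplus; ring_R. }
    destruct M as [|N]; [lia|].
    rewrite sum_n_S_l, sum_Lambda_degree; unfold E at 1; replace (S N - 1)%nat with N by lia.
    match goal with |- plus 0 ?x = ?y => transitivity x; [apply Rplus_0_l|] end.
    apply sum_n_ext; intros e; unfold E; apply sum_n_ext_loc; intros m Hm.
    rewrite Hpoly_hpoly; now replace (m + (e - m + 2))%nat with (S (S e)) by lia.
  - intros d; rewrite !Gpoly_hpoly.
    rewrite (proj2 (Lin (S d)) _ (fun a => (0 + D 0%nat (S d) * Gcoef 0 a + D 1%nat d * Gcoef 1 a)
      + -1 * match d with O => 0
      | S e => sum_n (fun m => F m (e - m)%nat * Hcoef m a) e end)).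
    + rewrite !(proj1 (Lin (S d))), (linear_upto_zero _ _ (Lin (S d))).
      replace (L (hpoly (S d) (fun a => match d with O => 0
        | S e => sum_n (fun m => F m (e - m)%nat * Hcoef m a) e end))) with (E d).
      { simpl Nat.add; ring_R. }
      destruct d as [|e]; simpl E.
      * now rewrite (linear_upto_zero _ _ (Lin 1%nat)).
      * symmetry; apply (linear_upto_sum (S (S e)) _ _ Hcoef e (Lin (S (S e)))).
    + intros a Ha; rewrite (jet_elimination D F d a PDE Ha); ring.
Qed.

(** * Leading coefficients along the curve *)

(** In Leibniz's formula for a product with a function that vanishes to order
    [n] only one term of order [n] survives. *)
Lemma Derive_n_mult_lead (f g : R -> R) (n : nat) :
  smooth1_near f 0 -> smooth1_near g 0 ->
  (forall k, (k < n)%nat -> Derive_n f k 0 = 0) ->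
  (forall k, (k < n)%nat -> Derive_n (fun t => f t * g t) k 0 = 0) /\
  Derive_n (fun t => f t * g t) n 0 = Derive_n f n 0 * g 0.
Proof.
  revert f g; induction n as [|n IH]; intros f g Hf Hg V; [now split; [lia|]|].
  assert (Hf' := smooth1_near_Derive _ _ Hf); assert (Hg' := smooth1_near_Derive _ _ Hg).
  destruct (IH (Derive f) g Hf' Hg) as [A1 A2].
  { intros k Hk; rewrite <- Derive_n_S; apply V; lia. }
  destruct (IH f (Derive g) Hf Hg') as [B1 B2]; [intros k Hk; apply V; lia|].
  assert (E : forall k, Derive_n (fun t => f t * g t) (S k) 0 =
    Derive_n (fun t => Derive f t * g t) k 0 + Derive_n (fun t => f t * Derive g t) k 0).
  { intros k; rewrite Derive_n_S, <- Derive_n_plus_smooth by (now apply smooth1_near_mult).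
    apply Derive_n_ext_loc; generalize (locally_is_derive_mult f g 0 Hf Hg).
    apply filter_imp; intros t; apply is_derive_unique. }
  split.
  - intros [|k] Hk; simpl.
    + change (f 0) with (Derive_n f 0 0); rewrite V by lia; ring.
    + change (Derive_n (fun t => f t * g t) (S k) 0 = 0); rewrite E, A1, B1 by lia; ring.
  - rewrite E, A2, B2, (V n) by lia; rewrite <- Derive_n_S; ring.
Qed.

Section Leading.

Variables r s : R -> R.
Hypotheses (Hr : smooth1_near r 0) (Hs : smooth1_near s 0) (r0 : r 0 = 0) (s0 : s 0 = 0).

Lemma smooth1_near_hpoly_curve (d : nat) (c : nat -> R) :
  smooth1_near (fun t => hpoly d c (r t) (s t)) 0.
Proof using Hr Hs. apply (smooth1_near_comp (hpoly d c)); auto using smooth2_near_hpoly. Qed.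

(** Euler's identity propagates the leading term from degree [d] to degree
    [d + 1]. *)
Lemma Derive_n_hpoly_curve (d : nat) (c : nat -> R) :
  (forall k, (k < d)%nat -> Derive_n (fun t => hpoly d c (r t) (s t)) k 0 = 0) /\
  Derive_n (fun t => hpoly d c (r t) (s t)) d 0 =
    INR (fact d) * hpoly d c (Derive r 0) (Derive s 0).
Proof using Hr Hs r0 s0.
  revert c; induction d as [|d IH]; intros c.
  - split; [lia|]; simpl; rewrite !hpoly_0; ring.
  - assert (Hr' := smooth1_near_Derive _ _ Hr); assert (Hs' := smooth1_near_Derive _ _ Hs).
    destruct (IH (fun a => c (S a))) as [X1 X2]; destruct (IH c) as [Y1 Y2].
    assert (Sx := smooth1_near_hpoly_curve d (fun a => c (S a))).
    assert (Sy := smooth1_near_hpoly_curve d c).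
    destruct (Derive_n_mult_lead _ (Derive r) d Sx Hr' X1) as [A1 A2].
    destruct (Derive_n_mult_lead _ (Derive s) d Sy Hs' Y1) as [B1 B2].
    assert (E : forall k, Derive_n (fun t => hpoly (S d) c (r t) (s t)) (S k) 0 =
      Derive_n (fun t => hpoly d (fun a => c (S a)) (r t) (s t) * Derive r t) k 0
      + Derive_n (fun t => hpoly d c (r t) (s t) * Derive s t) k 0).
    { intros k; rewrite Derive_n_S, <- Derive_n_plus_smooth
        by (apply smooth1_near_mult; assumption).
      apply Derive_n_ext_loc.
      generalize (locally_is_derive_comp_2d (hpoly (S d) c) r s 0
        (smooth2_near_hpoly _ _ _ _) Hr Hs).
      rewrite dx_hpoly, dy_hpoly; apply filter_imp; intros t; apply is_derive_unique. }
    split.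
    + intros [|k] Hk.
      * simpl; now rewrite r0, s0, hpoly_origin.
      * rewrite E, A1, B1 by lia; ring.
    + rewrite E, A2, B2, X2, Y2.
      assert (Eu := hpoly_euler d c (Derive r 0) (Derive s 0)).
      change (fact (S d)) with (S d * fact d)%nat; rewrite mult_INR.
      transitivity (INR (fact d) * (INR (S d) * hpoly (S d) c (Derive r 0) (Derive s 0)));
        [rewrite <- Eu|]; ring.
Qed.

Lemma Derive_n_conormal_curve (d : nat) (c : nat -> R) :
  (forall k, (k < d)%nat -> Derive_n (along_conormal r s (hpoly (S d) c)) k 0 = 0) /\
  Derive_n (along_conormal r s (hpoly (S d) c)) d 0 =
    INR (fact d) * (hpoly d (fun a => c (S a)) (Derive r 0) (Derive s 0) * Derive s 0
      - hpoly d c (Derive r 0) (Derive s 0) * Derive r 0).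
Proof using Hr Hs r0 s0.
  assert (Hr' := smooth1_near_mult _ _ _ (smooth1_near_const (-1) _) (smooth1_near_Derive _ _ Hr)).
  assert (Hs' := smooth1_near_Derive _ _ Hs).
  destruct (Derive_n_hpoly_curve d (fun a => c (S a))) as [X1 X2].
  destruct (Derive_n_hpoly_curve d c) as [Y1 Y2].
  assert (Sx := smooth1_near_hpoly_curve d (fun a => c (S a))).
  assert (Sy := smooth1_near_hpoly_curve d c).
  destruct (Derive_n_mult_lead _ (Derive s) d Sx Hs' X1) as [A1 A2].
  destruct (Derive_n_mult_lead _ _ d Sy Hr' Y1) as [B1 B2].
  assert (E : forall k, Derive_n (along_conormal r s (hpoly (S d) c)) k 0 =
    Derive_n (fun t => hpoly d (fun a => c (S a)) (r t) (s t) * Derive s t) k 0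
    + Derive_n (fun t => hpoly d c (r t) (s t) * (-1 * Derive r t)) k 0).
  { intros k; rewrite <- Derive_n_plus_smooth by (apply smooth1_near_mult; assumption).
    apply Derive_n_ext; intros; apply along_conormal_hpoly_S. }
  split.
  - intros k Hk; rewrite E, A1, B1 by exact Hk; ring.
  - rewrite E, A2, B2, X2, Y2; ring.
Qed.

Lemma gc_low (m n p : nat) : (p < m + n)%nat -> gc r s m n p = 0.
Proof using Hr Hs r0 s0.
  intros H; unfold gc, tcoef; rewrite Gpoly_hpoly.
  rewrite (proj1 (Derive_n_hpoly_curve _ _)) by exact H; unfold Rdiv; ring.
Qed.

Lemma gc_lead (m n : nat) :
  gc r s m n (m + n) = hpoly (m + n) (Gcoef m) (Derive r 0) (Derive s 0).
Proof using Hr Hs r0 s0.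
  unfold gc, tcoef; rewrite Gpoly_hpoly, (proj2 (Derive_n_hpoly_curve _ _)).
  field; apply INR_fact_neq_0.
Qed.

Lemma gtc_low (m n p : nat) : (S p < m + n)%nat -> gtc r s m n p = 0.
Proof using Hr Hs r0 s0.
  intros H; unfold gtc, tcoef; rewrite Gpoly_hpoly.
  destruct (m + n)%nat as [|d]; [lia|].
  rewrite (proj1 (Derive_n_conormal_curve _ _)) by lia; unfold Rdiv; ring.
Qed.

Lemma gtc_lead (m n d : nat) :
  (m + n = S d)%nat ->
  gtc r s m n d = hpoly d (fun a => Gcoef m (S a)) (Derive r 0) (Derive s 0) * Derive s 0
    - hpoly d (Gcoef m) (Derive r 0) (Derive s 0) * Derive r 0.
Proof using Hr Hs r0 s0.
  intros H; unfold gtc, tcoef; rewrite Gpoly_hpoly, H, (proj2 (Derive_n_conormal_curve _ _)).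
  field; apply INR_fact_neq_0.
Qed.

Lemma gc_00 (p : nat) : gc r s 0 0 p = if (p =? 0)%nat then 1 else 0.
Proof using.
  unfold gc; rewrite (tcoef_ext _ (fun _ => 1)).
  - unfold tcoef; destruct p as [|p]; [simpl; field|].
    rewrite Derive_n_const; unfold Rdiv; simpl; ring.
  - intros t; rewrite Gpoly_hpoly, hpoly_0; reflexivity.
Qed.

Lemma gtc_00 (p : nat) : gtc r s 0 0 p = 0.
Proof using.
  unfold gtc; rewrite (tcoef_ext _ (fun _ => 0)).
  - unfold tcoef; destruct p as [|p]; [simpl; unfold Rdiv; ring|].
    rewrite Derive_n_const; unfold Rdiv; simpl; ring.
  - intros t; rewrite Gpoly_hpoly; unfold along_conormal; rewrite dx_hpoly_0, dy_hpoly_0; ring.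
Qed.

End Leading.

Lemma hpoly_Gcoef_0_S (d : nat) (x y : R) :
  hpoly d (fun a => Gcoef 0 (S a)) x y = - hpoly d (Gcoef 1) x y.
Proof.
  rewrite (hpoly_ext d (fun a => Gcoef 0 (S a)) (fun a => 0 + -1 * Gcoef 1 a))
    by (intros; rewrite Gcoef_0_S; ring).
  rewrite (hpoly_axpy d (fun _ => 0)).
  replace (hpoly d (fun _ => 0) x y) with 0; [ring|].
  symmetry; apply sum_n_eq_0; intros; ring.
Qed.

(** Multiplication of [(y + i x)^d / d!], whose real and imaginary parts are
    these two polynomials, by [y + i x]; it follows from Euler's identity and
    the Cauchy-Riemann equations. *)
Lemma hpoly_complex_power_S (d : nat) (x y : R) :
  y * hpoly d (Gcoef 0) x y - x * hpoly d (Gcoef 1) x y =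
    INR (S d) * hpoly (S d) (Gcoef 0) x y /\
  x * hpoly d (Gcoef 0) x y + y * hpoly d (Gcoef 1) x y =
    INR (S d) * hpoly (S d) (Gcoef 1) x y.
Proof.
  rewrite <- !hpoly_euler.
  rewrite (hpoly_ext d (fun a => Gcoef 1 (S a)) (Gcoef 0)) by (intros; apply Gcoef_1_S).
  rewrite hpoly_Gcoef_0_S; split; ring.
Qed.

(** The squared modulus of [(y + i x)^d / d!]. *)
Lemma hpoly_modulus_pos (d : nat) (x y : R) :
  x ^ 2 + y ^ 2 > 0 ->
  hpoly d (Gcoef 0) x y ^ 2 + hpoly d (Gcoef 1) x y ^ 2 > 0.
Proof.
  intros H; induction d as [|d IH].
  - rewrite !hpoly_0; unfold Gcoef; simpl; lra.
  - destruct (hpoly_complex_power_S d x y) as [E0 E1].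
    assert (N : INR (S d) > 0) by (apply lt_0_INR; lia).
    assert (E : INR (S d) ^ 2 * (hpoly (S d) (Gcoef 0) x y ^ 2 + hpoly (S d) (Gcoef 1) x y ^ 2) =
      (x ^ 2 + y ^ 2) * (hpoly d (Gcoef 0) x y ^ 2 + hpoly d (Gcoef 1) x y ^ 2)).
    { transitivity ((INR (S d) * hpoly (S d) (Gcoef 0) x y) ^ 2
        + (INR (S d) * hpoly (S d) (Gcoef 1) x y) ^ 2); [ring|].
      rewrite <- E0, <- E1; ring. }
    assert (P := Rmult_gt_0_compat _ _ H IH); rewrite <- E in P.
    assert (N2 : 0 < INR (S d) ^ 2) by (apply pow_lt; exact N).
    apply Rmult_lt_reg_l with (1 := N2); rewrite Rmult_0_r; exact P.
Qed.

(** With [P + i Q = z^p / p!] and [z = s'(0) + i r'(0)], the conormal derivative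
    multiplies a power [z^p] by [p i], so the matrix of the system has rows
    [(P, Q)] and [(-p Q, p P)]. *)
Lemma Qdet_neq_0 (r s : R -> R) (p : nat) :
  smooth1_near r 0 -> smooth1_near s 0 -> r 0 = 0 -> s 0 = 0 ->
  Derive r 0 ^ 2 + Derive s 0 ^ 2 > 0 ->
  (1 <= p)%nat -> Qdet r s p <> 0.
Proof.
  intros Hr Hs r0 s0 Sp Hp; destruct p as [|d]; [lia|]; unfold Qdet.
  replace (S d - 1)%nat with d by lia.
  assert (G0 := gc_lead r s Hr Hs r0 s0 0 (S d)); assert (G1 := gc_lead r s Hr Hs r0 s0 1 d).
  simpl Nat.add in G0, G1; rewrite G0, G1.
  rewrite (gtc_lead r s Hr Hs r0 s0 0 (S d) d), (gtc_lead r s Hr Hs r0 s0 1 d d) by lia.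
  set (a := Derive r 0) in *; set (b := Derive s 0) in *.
  destruct (hpoly_complex_power_S d a b) as [E0 E1].
  rewrite (hpoly_ext d (fun a => Gcoef 1 (S a)) (Gcoef 0)) by (intros; apply Gcoef_1_S).
  assert (Eu := hpoly_euler d (Gcoef 0) a b).
  assert (M := hpoly_modulus_pos (S d) a b Sp).
  assert (N : INR (S d) > 0) by (apply lt_0_INR; lia).
  rewrite hpoly_Gcoef_0_S.
  match goal with |- ?e <> 0 => replace e with
    (INR (S d) * (hpoly (S d) (Gcoef 0) a b ^ 2 + hpoly (S d) (Gcoef 1) a b ^ 2)) end.
  - apply Rgt_not_eq, Rmult_gt_0_compat; assumption.
  - transitivity (hpoly (S d) (Gcoef 0) a b * (INR (S d) * hpoly (S d) (Gcoef 0) a b)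
      + hpoly (S d) (Gcoef 1) a b * (INR (S d) * hpoly (S d) (Gcoef 1) a b)); [ring|].
    rewrite <- E0, <- E1; ring.
Qed.

(** * The recursion *)

Lemma sum_n_m_morphism {G H : AbelianMonoid} (phi : G -> H) (a : nat -> G) (n m : nat) :
  phi zero = zero -> (forall x y, phi (plus x y) = plus (phi x) (phi y)) ->
  phi (sum_n_m a n m) = sum_n_m (fun k => phi (a k)) n m.
Proof.
  intros Z P; destruct (le_lt_dec n m) as [L|L]; [|now rewrite !sum_n_m_zero].
  induction m as [|m IH].
  - replace n with 0%nat by lia; now rewrite !sum_n_n.
  - destruct (Nat.eq_dec n (S m)) as [->|N]; [now rewrite !sum_n_n|].
    rewrite !sum_n_Sm, P, IH by lia; reflexivity.
Qed.

Lemma sum_Lambda_morphism {G H : AbelianMonoid} (phi : G -> H) (K : nat) (a : nat -> nat -> G) :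
  phi zero = zero -> (forall x y, phi (plus x y) = plus (phi x) (phi y)) ->
  phi (sum_Lambda K a) = sum_Lambda K (fun m n => phi (a m n)).
Proof.
  intros Z P; unfold sum_Lambda, sum_n; rewrite sum_n_m_morphism by assumption.
  apply sum_n_m_ext; intros m; now apply sum_n_m_morphism.
Qed.

Lemma sum_Lambda_ext {G : AbelianMonoid} (K : nat) (a b : nat -> nat -> G) :
  (forall m n, (m + n <= K)%nat -> a m n = b m n) -> sum_Lambda K a = sum_Lambda K b.
Proof.
  intros H; apply sum_n_ext_loc; intros m Hm; apply sum_n_ext_loc; intros n Hn; apply H; lia.
Qed.

Lemma sum_Lambda_plus (K : nat) (a b : nat -> nat -> R) :
  sum_Lambda (V := R_AbelianMonoid) K (fun m n => a m n + b m n)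
  = sum_Lambda K a + sum_Lambda K b.
Proof.
  unfold sum_Lambda; rewrite <- sum_n_Rplus; apply sum_n_ext; intros m; apply sum_n_Rplus.
Qed.

Lemma sum_Lambda_mult_l (K : nat) (c : R) (a : nat -> nat -> R) :
  sum_Lambda (V := R_AbelianMonoid) K (fun m n => c * a m n) = c * sum_Lambda K a.
Proof.
  unfold sum_Lambda; rewrite <- sum_n_Rmult_l; apply sum_n_ext; intros m; apply sum_n_Rmult_l.
Qed.

Section Linear.

Variables (V W : ModuleSpace R_Ring) (phi : V -> W).
Hypotheses (phi_plus : forall x y, phi (plus x y) = plus (phi x) (phi y))
  (phi_scal : forall k x, phi (scal k x) = scal k (phi x)).

Lemma linear_zero : phi zero = zero.
Proof using phi_scal. rewrite <- (scal_zero_l (V := V) zero), phi_scal; exact (scal_zero_l (V := W) _). Qed.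

Lemma linear_minus x y : phi (minus x y) = minus (phi x) (phi y).
Proof using phi_plus phi_scal.
  unfold minus; rewrite phi_plus, <- (scal_opp_one y), phi_scal; now rewrite scal_opp_one.
Qed.

Variables (M : nat) (fp fm g1 g : nat -> nat -> V) (fp' fm' g1' g' : nat -> nat -> W).
Hypotheses
  (Hf : forall m n, (m + n <= M - 1)%nat -> phi (fp m n) = fp' m n /\ phi (fm m n) = fm' m n)
  (Hg1 : forall m n, (m + n <= M + 1)%nat -> phi (g1 m n) = g1' m n)
  (Hg : forall m n, (m + n <= M)%nat -> phi (g m n) = g' m n).

(** Only the data of the orders that occur in the recursion have to correspond,
    which allows a linear map that forgets the other symbols. *)
Lemma recursion_linear (r s : R -> R) (sigma : R) (U : nat -> nat -> V) :
  satisfies_recursion r s M sigma fp fm g1 g U ->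
  satisfies_recursion r s M sigma fp' fm' g1' g' (fun m n => phi (U m n)).
Proof using All.
  assert (Z := linear_zero).
  assert (EF : forall p, phi (rhsF r s M fp fm g1 p) = rhsF r s M fp' fm' g1' p).
  { intros p; unfold rhsF; rewrite phi_plus, !(sum_Lambda_morphism phi) by assumption; f_equal;
      apply sum_Lambda_ext; intros m n H; rewrite phi_scal.
    - destruct (Hf m n H) as [<- <-]; now rewrite linear_minus.
    - now rewrite Hg1. }
  assert (EG : forall p, phi (rhsG r s M sigma fp fm g p) = rhsG r s M sigma fp' fm' g' p).
  { intros p; unfold rhsG; rewrite phi_plus, phi_scal, !(sum_Lambda_morphism phi) by assumption.
    f_equal; [|f_equal]; apply sum_Lambda_ext; intros m n H; rewrite phi_scal.
    - destruct (Hf m n H) as [<- <-]; now rewrite linear_minus.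
    - now rewrite Hg. }
  set (phi2 (v : V * V) := (phi (fst v), phi (snd v))).
  assert (EQ : forall A v, phi2 (mat2_apply A v) = mat2_apply A (phi2 v)).
  { intros A v; unfold phi2, mat2_apply; simpl; now rewrite !phi_plus, !phi_scal. }
  intros [U0 UR]; split; [rewrite U0; apply Hg1; lia|].
  intros p Hp; change (phi2 (U 0%nat p, U 1%nat (p - 1)%nat) =
    rec_step r s M sigma fp' fm' g1' g' (fun m n => phi (U m n)) p).
  rewrite (UR p Hp); unfold rec_step.
  transitivity (minus (phi2 (mat2_apply (Qmat r s p) (rhsF r s M fp fm g1 p, rhsG r s M sigma fp fm g (p - 1))))
    (phi2 (sum_n_m (fun n => mat2_apply (Qmat r s p)
       (plus (scal (gc r s 0 n p) (U 0%nat n)) (scal (gc r s 1 (n - 1) p) (U 1%nat (n - 1)%nat)),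
        plus (scal (gtc r s 0 n (p - 1)) (U 0%nat n))
          (scal (gtc r s 1 (n - 1) (p - 1)) (U 1%nat (n - 1)%nat)))) 1 (p - 1)))).
  - unfold phi2 at 1; apply injective_projections; apply linear_minus.
  - f_equal.
    + rewrite EQ; unfold phi2; simpl; now rewrite EF, EG.
    + rewrite (sum_n_m_morphism phi2).
      * apply sum_n_m_ext; intros n; rewrite EQ; unfold phi2; simpl.
        now rewrite !phi_plus, !phi_scal.
      * unfold phi2; simpl; now rewrite Z.
      * intros x y; unfold phi2; simpl; now rewrite !phi_plus.
Qed.

End Linear.

Lemma recursion_unique (r s : R -> R) (V : ModuleSpace R_Ring) (M : nat) (sigma : R)
    (fp fm g1 g : nat -> nat -> V) (U U' : nat -> nat -> V) :
  satisfies_recursion r s M sigma fp fm g1 g U ->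
  satisfies_recursion r s M sigma fp fm g1 g U' ->
  forall m n, in_Lambda1 (M + 1) m n -> U m n = U' m n.
Proof.
  intros [U0 UR] [U0' UR'].
  assert (H : forall p, (p <= M + 1)%nat -> U 0%nat p = U' 0%nat p /\
    ((1 <= p)%nat -> U 1%nat (p - 1)%nat = U' 1%nat (p - 1)%nat)).
  { induction p as [p IH] using lt_wf_ind; intros Hp.
    destruct p as [|p]; [split; [now rewrite U0, U0'|lia]|].
    assert (E : (U 0%nat (S p), U 1%nat (S p - 1)%nat) = (U' 0%nat (S p), U' 1%nat (S p - 1)%nat)).
    { rewrite UR, UR' by lia; unfold rec_step; f_equal; apply sum_n_m_ext_loc; intros n Hn.
      destruct (IH n ltac:(lia) ltac:(lia)) as [E0 E1]; now rewrite E0, E1 by lia. }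
    injection E; intros E1 E0; now split. }
  intros m n [Hmn [->| ->]]; [apply H; lia|].
  replace n with (S n - 1)%nat by lia; apply H; lia.
Qed.

Definition same_coefs (M : nat) (r s r' s' : R -> R) : Prop :=
  (forall m n p, (p <= M + 1)%nat -> gc r s m n p = gc r' s' m n p /\
     hc r s m n p = hc r' s' m n p /\ rc r s m n p = rc r' s' m n p) /\
  (forall m n p, (p <= M)%nat -> gtc r s m n p = gtc r' s' m n p /\
     htc r s m n p = htc r' s' m n p /\ rtc r s m n p = rtc r' s' m n p).

Lemma recursion_same_coefs (r s r' s' : R -> R) (V : ModuleSpace R_Ring) (M : nat) (sigma : R)
    (fp fm g1 g : nat -> nat -> V) (U : nat -> nat -> V) :
  same_coefs M r s r' s' ->
  satisfies_recursion r s M sigma fp fm g1 g U ->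
  satisfies_recursion r' s' M sigma fp fm g1 g U.
Proof.
  intros [C1 C2] [U0 UR]; split; [exact U0|]; intros p Hp; rewrite (UR p Hp).
  assert (G := fun m n => proj1 (C1 m n p (proj2 Hp))).
  assert (H := fun m n => proj1 (proj2 (C1 m n p (proj2 Hp)))).
  assert (K := fun m n => proj2 (proj2 (C1 m n p (proj2 Hp)))).
  assert (Hp' : (p - 1 <= M)%nat) by lia.
  assert (Gt := fun m n => proj1 (C2 m n (p - 1)%nat Hp')).
  assert (Ht := fun m n => proj1 (proj2 (C2 m n (p - 1)%nat Hp'))).
  assert (Kt := fun m n => proj2 (proj2 (C2 m n (p - 1)%nat Hp'))).
  assert (EQ : Qmat r s p = Qmat r' s' p) by (unfold Qmat, Qdet; now rewrite !G, !Gt).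
  unfold rec_step; rewrite EQ; f_equal.
  - f_equal; f_equal.
    + unfold rhsF; f_equal; apply sum_Lambda_ext; intros; now rewrite ?H, ?K.
    + unfold rhsG; f_equal; [|f_equal]; apply sum_Lambda_ext; intros; now rewrite ?Ht, ?Kt.
  - apply sum_n_m_ext; intros n; now rewrite !G, !Gt.
Qed.

Lemma mat2_apply_R_plus (A : (R * R) * (R * R)) (v w : R * R) :
  mat2_apply (V := R_ModuleSpace) A (plus v w) =
  plus (mat2_apply (V := R_ModuleSpace) A v) (mat2_apply (V := R_ModuleSpace) A w).
Proof.
  apply injective_projections; simpl; unfold plus, scal; simpl; unfold mult; simpl; ring.
Qed.

(** Cramer's rule: the recursion solves the triangular system obtained by
    comparing Taylor coefficients. *)
Lemma recursion_of_system (r s : R -> R) (M : nat) (sigma : R)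
    (fp fm g1 g U : nat -> nat -> R) :
  U 0%nat 0%nat = g1 0%nat 0%nat ->
  (forall p, (1 <= p <= M + 1)%nat -> Qdet r s p <> 0 /\
    sum_n (fun d => U 0%nat (S d) * gc r s 0 (S d) p + U 1%nat d * gc r s 1 d p) (p - 1) =
      rhsF r s (V := R_ModuleSpace) M fp fm g1 p /\
    sum_n (fun d => U 0%nat (S d) * gtc r s 0 (S d) (p - 1) + U 1%nat d * gtc r s 1 d (p - 1)) (p - 1) =
      rhsG r s (V := R_ModuleSpace) M sigma fp fm g (p - 1)) ->
  satisfies_recursion r s (V := R_ModuleSpace) M sigma fp fm g1 g U.
Proof.
  intros U0 Sys; split; [exact U0|]; intros p Hp; destruct (Sys p Hp) as (Q0 & EF & EG).
  unfold rec_step.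
  rewrite <- (sum_n_m_morphism (mat2_apply (V := R_ModuleSpace) (Qmat r s p))
    (fun n => (plus (scal (gc r s 0 n p) (U 0%nat n)) (scal (gc r s 1 (n - 1) p) (U 1%nat (n - 1)%nat)),
      plus (scal (gtc r s 0 n (p - 1)) (U 0%nat n))
        (scal (gtc r s 1 (n - 1) (p - 1)) (U 1%nat (n - 1)%nat))) : R * R)).
  2: { apply injective_projections; simpl; unfold plus, scal, zero; simpl; unfold mult; simpl; ring. }
  2: apply mat2_apply_R_plus.
  rewrite <- EF, <- EG.
  destruct p as [|q]; [lia|]; replace (S q - 1)%nat with q by lia.
  (* [T] is the contribution of the degrees below [p]; [ET] splits off the top one. *)
  match goal with |- context [sum_n_m ?a 1 q] => set (T := sum_n_m a 1 q) end.
  assert (ET : forall (h : R * R -> R) (u : nat -> nat -> R),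
    h zero = 0 -> (forall x y, h (plus x y) = h x + h y) ->
    (forall d, h (plus (scal (gc r s 0 (S d) (S q)) (U 0%nat (S d))) (scal (gc r s 1 d (S q)) (U 1%nat d)),
      plus (scal (gtc r s 0 (S d) q) (U 0%nat (S d))) (scal (gtc r s 1 d q) (U 1%nat d))) =
      U 0%nat (S d) * u 0%nat (S d) + U 1%nat d * u 1%nat d) ->
    sum_n (fun d => U 0%nat (S d) * u 0%nat (S d) + U 1%nat d * u 1%nat d) q =
    h T + (U 0%nat (S q) * u 0%nat (S q) + U 1%nat q * u 1%nat q)).
  { intros h u hZ hP hE; unfold T; clear T.
    rewrite (sum_n_m_morphism (H := R_AbelianMonoid) h) by assumption.
    destruct q as [|q].
    - rewrite sum_O, sum_n_m_zero by lia; symmetry; apply Rplus_0_l.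
    - rewrite sum_Sn, <- sum_n_m_S.
      apply (f_equal (fun z : R => z + _)); apply sum_n_ext; intros d.
      now replace (S d - 1)%nat with d by lia. }
  rewrite (ET fst (fun m n => gc r s m n (S q))), (ET snd (fun m n => gtc r s m n q)).
  2,5: reflexivity. 2,4: intros; reflexivity.
  2,3: intros; simpl; unfold plus, scal; simpl; unfold mult; simpl; ring.
  clearbody T; unfold Qmat, Qdet in *; replace (S q - 1)%nat with q in * by lia.
  apply injective_projections; simpl; unfold minus, plus, scal, opp; simpl; unfold mult; simpl;
    field; exact Q0.
Qed.

(** * Transmission coefficients *)

Section Evaluation.

Variables (M : nat) (fp fm g1 g : nat -> nat -> R).

(** A linear combination may involve infinitely many symbols, so the sum is
    restricted to the orders that the recursion uses. *)
Definition evaluate (v : formal) : R :=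
  sum_Lambda (M - 1) (fun m n => v (sym_fp m n) * fp m n + v (sym_fm m n) * fm m n)
  + sum_Lambda (M + 1) (fun m n => v (sym_g1 m n) * g1 m n)
  + sum_Lambda M (fun m n => v (sym_g m n) * g m n).

Lemma evaluate_plus (v w : formal) : evaluate (plus v w) = evaluate v + evaluate w.
Proof.
  unfold evaluate.
  assert (E : forall a, (plus v w : formal) a = v a + w a) by reflexivity.
  rewrite (sum_Lambda_ext (M - 1) _ (fun m n => (v (sym_fp m n) * fp m n + v (sym_fm m n) * fm m n)
    + (w (sym_fp m n) * fp m n + w (sym_fm m n) * fm m n)))
    by (intros; rewrite !E; ring_R).
  rewrite (sum_Lambda_ext (M + 1) _ (fun m n => v (sym_g1 m n) * g1 m n + w (sym_g1 m n) * g1 m n))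
    by (intros; rewrite !E; ring_R).
  rewrite (sum_Lambda_ext M _ (fun m n => v (sym_g m n) * g m n + w (sym_g m n) * g m n))
    by (intros; rewrite !E; ring_R).
  rewrite !sum_Lambda_plus; ring_R.
Qed.

Lemma evaluate_scal (k : R) (v : formal) : evaluate (scal k v) = k * evaluate v.
Proof.
  unfold evaluate.
  assert (E : forall a, (scal k v : formal) a = k * v a) by reflexivity.
  rewrite (sum_Lambda_ext (M - 1) _ (fun m n => k * (v (sym_fp m n) * fp m n + v (sym_fm m n) * fm m n)))
    by (intros; rewrite !E; ring_R).
  rewrite (sum_Lambda_ext (M + 1) _ (fun m n => k * (v (sym_g1 m n) * g1 m n)))
    by (intros; rewrite !E; ring_R).
  rewrite (sum_Lambda_ext M _ (fun m n => k * (v (sym_g m n) * g m n)))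
    by (intros; rewrite !E; ring_R).
  rewrite !sum_Lambda_mult_l; ring_R.
Qed.

Lemma sum_Lambda_0 (K : nat) (a : nat -> nat -> R) :
  (forall m n, a m n = 0) -> sum_Lambda K a = 0.
Proof. intros H; apply sum_n_eq_0; intros m; apply sum_n_eq_0; auto. Qed.

Lemma sum_Lambda_single (K m n : nat) (a : nat -> nat -> R) :
  (m + n <= K)%nat -> (forall i j, (i, j) <> (m, n) -> a i j = 0) ->
  sum_Lambda K a = a m n.
Proof.
  intros H Z.
  rewrite (sum_Lambda_ext K a (fun i j => delta i m * (a i j * delta j n))).
  - unfold sum_Lambda.
    rewrite (sum_n_ext_loc _ (fun i => a i n * delta i m)).
    + rewrite sum_n_delta; now destruct (Nat.leb_spec m K); [|lia].
    + intros i Hi; rewrite sum_n_Rmult_l, sum_n_delta; unfold delta.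
      destruct (Nat.eqb_spec i m); [|ring_R].
      destruct (Nat.leb_spec n (K - i)); [ring_R|lia].
  - intros i j _; unfold delta; destruct (Nat.eqb_spec i m), (Nat.eqb_spec j n);
      try (rewrite Z by congruence); ring_R.
Qed.

Ltac monomial_values :=
  unfold monomial; intros;
  repeat match goal with |- context [symbol_eq_dec ?a ?b] =>
    destruct (symbol_eq_dec a b) end; try congruence; ring_R.

Lemma evaluate_f (m n : nat) :
  (m + n <= M - 1)%nat ->
  evaluate (monomial (sym_fp m n)) = fp m n /\ evaluate (monomial (sym_fm m n)) = fm m n.
Proof.
  intros H; unfold evaluate; split;
    rewrite (sum_Lambda_single (M - 1) m n), !sum_Lambda_0 by (exact H || monomial_values);
    monomial_values.
Qed.

Lemma evaluate_g1 (m n : nat) :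
  (m + n <= M + 1)%nat -> evaluate (monomial (sym_g1 m n)) = g1 m n.
Proof.
  intros H; unfold evaluate;
    rewrite (sum_Lambda_single (M + 1) m n), !sum_Lambda_0 by (exact H || monomial_values);
    monomial_values.
Qed.

Lemma evaluate_g (m n : nat) :
  (m + n <= M)%nat -> evaluate (monomial (sym_g m n)) = g m n.
Proof.
  intros H; unfold evaluate;
    rewrite (sum_Lambda_single M m n), !sum_Lambda_0 by (exact H || monomial_values);
    monomial_values.
Qed.

Lemma recursion_evaluate (r s : R -> R) (sigma : R) (U : nat -> nat -> R) :
  satisfies_recursion r s (V := R_ModuleSpace) M sigma fp fm g1 g U ->
  forall m n, in_Lambda1 (M + 1) m n -> U m n = evaluate (formal_jump r s M sigma m n).
Proof.
  intros HU; apply (recursion_unique r s R_ModuleSpace M sigma fp fm g1 g); [exact HU|].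
  apply (recursion_linear formal R_ModuleSpace evaluate evaluate_plus evaluate_scal M
    (fun m n => monomial (sym_fp m n)) (fun m n => monomial (sym_fm m n))
    (fun m n => monomial (sym_g1 m n)) (fun m n => monomial (sym_g m n)) fp fm g1 g).
  - exact evaluate_f.
  - exact evaluate_g1.
  - exact evaluate_g.
  - apply rec_solution_correct.
Qed.

Lemma evaluate_transmission (r s : R -> R) (sigma : R) (m' n' : nat) :
  evaluate (formal_jump r s M sigma m' n') = -
    (sum_Lambda (M - 1) (fun m n =>
       T_plus r s M sigma m' n' m n * fp m n + T_minus r s M sigma m' n' m n * fm m n)
     + sum_Lambda (M + 1) (fun m n => T_g1 r s M sigma m' n' m n * g1 m n)
     + sum_Lambda M (fun m n => T_g r s M sigma m' n' m n * g m n)).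
Proof.
  unfold evaluate, T_plus, T_minus, T_g1, T_g; set (v := formal_jump r s M sigma m' n').
  rewrite (sum_Lambda_ext (M - 1) (fun m n => - v (sym_fp m n) * fp m n + - v (sym_fm m n) * fm m n)
    (fun m n => -1 * (v (sym_fp m n) * fp m n + v (sym_fm m n) * fm m n))) by (intros; ring_R).
  rewrite (sum_Lambda_ext (M + 1) (fun m n => - v (sym_g1 m n) * g1 m n)
    (fun m n => -1 * (v (sym_g1 m n) * g1 m n))) by (intros; ring_R).
  rewrite (sum_Lambda_ext M (fun m n => - v (sym_g m n) * g m n)
    (fun m n => -1 * (v (sym_g m n) * g m n))) by (intros; ring_R).
  rewrite !sum_Lambda_mult_l; ring_R.
Qed.

End Evaluation.

(** * One-sided limits at the interface *)

Definition open2 (D : R -> R -> Prop) : Prop := forall x y, D x y -> locally_2d D x y.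

(** The formulation by neighborhoods makes limits and values along [D] comparable
    by intersecting finitely many conditions. *)
Definition adherent (D : R -> R -> Prop) (x y : R) : Prop :=
  forall P, locally_2d P x y -> exists a b, D a b /\ P a b.

Lemma adherent_ray (D : R -> R -> Prop) (x y a b h0 : R) :
  a ^ 2 + b ^ 2 = 1 -> 0 < h0 -> (forall h, 0 < h < h0 -> D (x + h * a) (y + h * b)) ->
  adherent D x y.
Proof.
  intros N H0 H P [d Hd].
  assert (d0 := cond_pos d); set (h := Rmin h0 d / 2).
  assert (M := Rmin_glb_lt h0 d 0 H0 d0); assert (M1 := Rmin_l h0 d); assert (M2 := Rmin_r h0 d).
  assert (Hh : 0 < h < h0 /\ h < d) by (unfold h; lra).
  exists (x + h * a), (y + h * b); split; [apply H; apply Hh|].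
  assert (B : forall c, c ^ 2 <= 1 -> Rabs (h * c) < d).
  { intros c Hc; apply Rabs_def1; nra. }
  apply Hd.
  - replace (x + h * a - x) with (h * a) by ring; apply B; nra.
  - replace (y + h * b - y) with (h * b) by ring; apply B; nra.
Qed.

Lemma lim_from_unique (D : R -> R -> Prop) (w we : R -> R -> R) (x y l : R) :
  adherent D x y -> continuity_2d_pt we x y ->
  locally_2d (fun a b => D a b -> we a b = w a b) x y ->
  lim_from D w x y l -> l = we x y.
Proof.
  intros A C E L; destruct (Req_dec l (we x y)) as [|N]; [assumption|exfalso].
  assert (N' : 0 < Rabs (l - we x y) / 2).
  { assert (T := Rabs_pos_lt (l - we x y)); lra. }
  set (e := mkposreal _ N').
  assert (L' : locally_2d (fun a b => D a b -> Rabs (w a b - l) < e) x y).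
  { apply locally_2d_locally; exact (L _ (locally_ball l e)). }
  destruct (A _ (locally_2d_and _ _ _ _ E (locally_2d_and _ _ _ _ L' (C e))))
    as (a & b & Dab & Eab & Lab & Cab).
  specialize (Eab Dab); specialize (Lab Dab); rewrite <- Eab in Lab; simpl in Lab, Cab.
  assert (T := Rabs_triang (we a b - we x y) (- (we a b - l))).
  rewrite Rabs_Ropp in T.
  replace (we a b - we x y + - (we a b - l)) with (l - we x y) in T by ring; lra.
Qed.

Lemma locally_2d_on_open (D P : R -> R -> Prop) (x y : R) :
  open2 D -> locally_2d (fun a b => D a b -> P a b) x y ->
  locally_2d (fun a b => D a b -> locally_2d P a b) x y.
Proof.
  intros O H; apply locally_2d_locally_2d in H; revert H.
  apply locally_2d_impl, locally_2d_forall; intros a b H Dab.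
  generalize (O a b Dab); revert H; apply locally_2d_impl.
Qed.

(** * One side of the interface *)

Section OneSide.

Variables (D : R -> R -> Prop) (u f ue fe : R -> R -> R) (x0 y0 : R).
Hypotheses (D_open : open2 D) (D_adh : adherent D x0 y0)
  (D_poisson : forall x y, D x y -> poisson_at u f x y)
  (Hu : smooth_extension D u ue x0 y0) (Hf : smooth_extension D f fe x0 y0).

Lemma extension_poisson :
  locally_2d (fun x y => D x y -> dx (dx ue) x y + 1 * dy (dy ue) x y + 1 * fe x y = 0) x0 y0.
Proof using D_open D_poisson Hu Hf.
  destruct Hu as [_ Eu], Hf as [_ Ef].
  generalize (locally_2d_and _ _ _ _ (locally_2d_on_open _ _ _ _ D_open Eu) Ef).
  apply locally_2d_impl, locally_2d_forall; intros x y [Eu' Ef'] Dxy.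
  specialize (Eu' Dxy); rewrite (Ef' Dxy).
  destruct (D_poisson x y Dxy) as (_ & _ & <-).
  assert (Ax : Derive_n (fun z => u z y) 2 x = Derive_n (fun z => ue z y) 2 x).
  { symmetry; apply Derive_n_ext_loc; exact (locally_2d_1d_const_y _ _ _ Eu'). }
  assert (Ay : Derive_n (fun z => u x z) 2 y = Derive_n (fun z => ue x z) 2 y).
  { symmetry; apply Derive_n_ext_loc; exact (locally_2d_1d_const_x _ _ _ Eu'). }
  rewrite Ax, Ay; unfold dx, dy; simpl; ring.
Qed.

Lemma Derive_n_zero (n : nat) (x : R) : Derive_n (fun _ => 0) n x = 0.
Proof using. destruct n; [easy|]; apply Derive_n_const. Qed.

(** The differentiated equation vanishes on the open side, and the point is a
    limit of points of that side. *)
Lemma extension_poisson_jet (m n : nat) :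
  jet2 ue x0 y0 (S (S m)) n + jet2 ue x0 y0 m (S (S n)) = - jet2 fe x0 y0 m n.
Proof using All.
  assert (E := locally_2d_on_open _ _ _ _ D_open extension_poisson).
  destruct Hu as [Su _], Hf as [Sf _].
  set (L := fun x y => dx (dx ue) x y + 1 * dy (dy ue) x y + 1 * fe x y) in E.
  assert (Sx := smooth2_near_dx _ _ _ (smooth2_near_dx _ _ _ Su)).
  assert (Sy := smooth2_near_dy _ _ _ (smooth2_near_dy _ _ _ Su)).
  assert (Sxy := smooth2_near_axpy _ _ 1 _ _ Sx Sy).
  assert (SL : smooth2_near L x0 y0) by exact (smooth2_near_axpy _ _ 1 _ _ Sxy Sf).
  assert (J : partial_derive m n L x0 y0 = jet2 ue x0 y0 (S (S m)) n + jet2 ue x0 y0 m (S (S n))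
    + jet2 fe x0 y0 m n).
  { unfold L, jet2.
    rewrite (partial_derive_axpy m n (fun x y => dx (dx ue) x y + 1 * dy (dy ue) x y) fe 1)
      by assumption.
    rewrite partial_derive_axpy by assumption.
    rewrite !partial_derive_dy, !partial_derive_dx by (try apply smooth2_near_dx; assumption); ring. }
  assert (Z : locally_2d (fun x y => D x y -> 0 = partial_derive m n L x y) x0 y0).
  { revert E; apply locally_2d_impl, locally_2d_forall; intros x y E Dxy.
    rewrite (partial_derive_ext_loc L (fun _ _ => 0) m n x y (E Dxy)); unfold partial_derive.
    rewrite (Derive_n_ext _ (fun _ => 0)); [now rewrite Derive_n_zero|intros; apply Derive_n_zero]. }
  assert (C := lim_from_unique D (partial_derive m n L) (fun _ _ => 0) x0 y0 (partial_derive m n L x0 y0)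
    D_adh (continuity_2d_pt_const _ _ _) Z).
  rewrite J in C; enough (jet2 ue x0 y0 (S (S m)) n + jet2 ue x0 y0 m (S (S n)) + jet2 fe x0 y0 m n = 0)
    by lra.
  apply C; clear C; rewrite <- J.
  intros P HP; apply filter_le_within.
  exact (proj1 (continuity_2d_pt_filterlim _ _ _)
    (partial_derive_continuous m n L x0 y0 SL) P HP).
Qed.

End OneSide.

(** Agreement with the extension on the open side, one neighborhood at a time,
    gives agreement of the first derivatives as well. *)
Lemma smooth_extension_limits (D : R -> R -> Prop) (u ue : R -> R -> R) (x0 y0 : R) :
  open2 D -> smooth_extension D u ue x0 y0 ->
  locally_2d (fun x y => adherent D x y ->
    (forall l, lim_from D u x y l -> l = ue x y) /\
    (forall a b l, lim_from D (fun x' y' => dx u x' y' * a + dy u x' y' * b) x y l ->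
       l = dx ue x y * a + dy ue x y * b)) x0 y0.
Proof.
  intros O [S E].
  assert (E1 := locally_2d_on_open _ _ _ _ O E).
  generalize (locally_2d_and _ _ _ _ (smooth2_near_open _ _ _ S)
    (locally_2d_and _ _ _ _ (locally_2d_locally_2d _ _ _ E) (locally_2d_locally_2d _ _ _ E1))).
  apply locally_2d_impl, locally_2d_forall; clear; intros x y (S & E & E1) A; split.
  - intros l; apply lim_from_unique; auto using smooth2_near_continuous.
  - intros a b l.
    apply (lim_from_unique D _ (fun x' y' => dx ue x' y' * a + dy ue x' y' * b)); [exact A| |].
    + apply continuity_2d_pt_plus; apply continuity_2d_pt_mult;
        try apply continuity_2d_pt_const; apply smooth2_near_continuous;
        [now apply smooth2_near_dx|now apply smooth2_near_dy].
    + revert E1; apply locally_2d_impl, locally_2d_forall; intros x' y' E1 Dxy.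
      assert (Ex := locally_2d_singleton _ _ _ (dx_ext_loc _ _ _ _ (E1 Dxy))).
      assert (Ey := locally_2d_singleton _ _ _ (dy_ext_loc _ _ _ _ (E1 Dxy))).
      cbv beta in Ex, Ey; now rewrite Ex, Ey.
Qed.

(** * The interface problem *)

Lemma locally_2d_gt (w : R -> R -> R) (x y c : R) :
  continuity_2d_pt w x y -> c < w x y -> locally_2d (fun a b => c < w a b) x y.
Proof.
  intros C H; assert (P : 0 < w x y - c) by lra.
  generalize (C (mkposreal _ P)); apply locally_2d_impl, locally_2d_forall; simpl.
  intros a b T; apply Rabs_def2 in T; lra.
Qed.

Lemma rect_open (l1 l2 l3 l4 : R) : open2 (rect l1 l2 l3 l4).
Proof.
  intros x y [[H1 H2] [H3 H4]].
  assert (P : 0 < Rmin (Rmin (x - l1) (l2 - x)) (Rmin (y - l3) (l4 - y)))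
    by (repeat apply Rmin_glb_lt; lra).
  exists (mkposreal _ P); simpl; intros u v Hu Hv.
  assert (A := Rmin_l (Rmin (x - l1) (l2 - x)) (Rmin (y - l3) (l4 - y))).
  assert (B := Rmin_r (Rmin (x - l1) (l2 - x)) (Rmin (y - l3) (l4 - y))).
  assert (A1 := Rmin_l (x - l1) (l2 - x)); assert (A2 := Rmin_r (x - l1) (l2 - x)).
  assert (B1 := Rmin_l (y - l3) (l4 - y)); assert (B2 := Rmin_r (y - l3) (l4 - y)).
  apply Rabs_def2 in Hu; apply Rabs_def2 in Hv; split; lra.
Qed.

Section Sides.

Variables (Omega : R -> R -> Prop) (psi nx ny : R -> R -> R).
Hypotheses (O_open : open2 Omega) (psi_smooth : forall x y, Omega x y -> smooth2_at psi x y)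
  (normal : unit_normal Omega psi nx ny).

Lemma Omega_plus_open : open2 (Omega_plus Omega psi).
Proof using O_open psi_smooth.
  intros x y [H P].
  generalize (locally_2d_and _ _ _ _ (O_open x y H)
    (locally_2d_gt psi x y 0 (proj1 (psi_smooth x y H 0%nat)) P)).
  apply locally_2d_impl, locally_2d_forall; intros a b []; now split.
Qed.

Lemma Omega_minus_open : open2 (Omega_minus Omega psi).
Proof using O_open psi_smooth.
  intros x y [H P].
  assert (C : continuity_2d_pt (fun a b => 0 + -1 * psi a b) x y).
  { apply continuity_2d_pt_plus; [apply continuity_2d_pt_const|].
    apply continuity_2d_pt_mult; [apply continuity_2d_pt_const|].
    exact (proj1 (psi_smooth x y H 0%nat)). }
  generalize (locally_2d_and _ _ _ _ (O_open x y H) (locally_2d_gt _ x y 0 C ltac:(lra))).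
  apply locally_2d_impl, locally_2d_forall; intros a b []; split; [assumption|lra].
Qed.

Lemma Gamma_adherent (x y : R) :
  Gamma Omega psi x y ->
  adherent (Omega_plus Omega psi) x y /\ adherent (Omega_minus Omega psi) x y.
Proof using normal.
  intros G; destruct (normal x y G) as (N & _ & h0 & H0 & H); split.
  - apply (adherent_ray _ x y (nx x y) (ny x y) h0); auto; intros; now apply H.
  - apply (adherent_ray _ x y (- nx x y) (- ny x y) h0); [nra|exact H0|].
    intros h Hh; rewrite <- !Ropp_mult_distr_r; now apply H.
Qed.

Variables (g1 g u up um : R -> R -> R) (xs ys : R).
Hypotheses
  (jump_u : forall x y, Gamma Omega psi x y -> is_jump Omega psi u x y (g1 x y))
  (jump_n : forall x y, Gamma Omega psi x y ->
     is_jump Omega psi (fun a b => dx u a b * nx x y + dy u a b * ny x y) x y (g x y))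
  (Hup : smooth_extension (Omega_plus Omega psi) u up xs ys)
  (Hum : smooth_extension (Omega_minus Omega psi) u um xs ys).

(** Both extensions are continuous up to the curve with their first derivatives,
    so their values there are the one-sided limits. *)
Lemma interface_jumps :
  locally_2d (fun x y => Gamma Omega psi x y ->
    up x y + -1 * um x y = g1 x y /\
    (dx up x y + -1 * dx um x y) * nx x y + (dy up x y + -1 * dy um x y) * ny x y = g x y) xs ys.
Proof using All.
  generalize (locally_2d_and _ _ _ _
    (smooth_extension_limits _ _ _ _ _ Omega_plus_open Hup)
    (smooth_extension_limits _ _ _ _ _ Omega_minus_open Hum)).
  apply locally_2d_impl, locally_2d_forall; intros x y [P Q] G.
  destruct (Gamma_adherent x y G) as [A B].
  destruct (P A) as [P1 P2], (Q B) as [Q1 Q2].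
  destruct (jump_u x y G) as (lp & lm & Lp & Lm & ->).
  destruct (jump_n x y G) as (np & nm & Np & Nm & ->).
  rewrite (P1 _ Lp), (Q1 _ Lm), (P2 _ _ _ Np), (Q2 _ _ _ Nm); split; ring.
Qed.

End Sides.

(** * Taylor coefficients of functions along the shifted curve *)

Definition speed (r s : R -> R) (t : R) : R := sqrt (Derive r t ^ 2 + Derive s t ^ 2).

Lemma smooth1_near_speed2 (r s : R -> R) (t : R) :
  smooth1_near r t -> smooth1_near s t ->
  smooth1_near (fun z => Derive r z ^ 2 + Derive s z ^ 2) t.
Proof.
  intros Hr Hs; assert (Hr' := smooth1_near_Derive _ _ Hr); assert (Hs' := smooth1_near_Derive _ _ Hs).
  assert (C := smooth1_near_const 1 t); simpl.
  exact (smooth1_near_plus _ _ _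
    (smooth1_near_mult _ _ _ Hr' (smooth1_near_mult _ _ _ Hr' C))
    (smooth1_near_mult _ _ _ Hs' (smooth1_near_mult _ _ _ Hs' C))).
Qed.

Lemma smooth1_near_speed (r s : R -> R) (t : R) :
  smooth1_near r t -> smooth1_near s t -> Derive r t ^ 2 + Derive s t ^ 2 > 0 ->
  smooth1_near (speed r s) t.
Proof.
  intros Hr Hs H.
  exact (smooth1_near_sqrt (fun z => Derive r z ^ 2 + Derive s z ^ 2) t
    (smooth1_near_speed2 _ _ _ Hr Hs) H).
Qed.

(** Valid without differentiability, as the difference quotients coincide. *)
Lemma Derive_shift (f : R -> R) (c : R) : Derive (fun t => f t + c) = Derive f.
Proof.
  apply functional_extensionality; intros t; unfold Derive; f_equal; apply Lim_ext.
  intros h; f_equal; ring.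
Qed.

Lemma tcoef_scal (c : R) (f : R -> R) (p : nat) : tcoef (fun t => c * f t) p = c * tcoef f p.
Proof. unfold tcoef; rewrite Derive_n_scal_l; unfold Rdiv; ring. Qed.

Lemma curve_coef_delta (r s W : R -> R) (m n p : nat) :
  curve_coef r s W p (hpoly (m + n) (delta m)) =
  tcoef (fun t => r t ^ m * s t ^ n * W t) p / (INR (fact m) * INR (fact n)).
Proof.
  unfold curve_coef; rewrite (tcoef_ext _ (fun t => / (INR (fact m) * INR (fact n))
    * (r t ^ m * s t ^ n * W t))).
  - rewrite tcoef_scal; unfold Rdiv; ring.
  - intros t; rewrite hpoly_delta by lia; replace (m + n - m)%nat with n by lia.
    unfold divpow; field; split; apply INR_fact_neq_0.
Qed.

Lemma curve_coef_1 (r s : R -> R) (p : nat) (w : R -> R -> R) :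
  curve_coef r s (fun _ => 1) p w = tcoef (fun t => w (r t) (s t)) p.
Proof. apply tcoef_ext; intros; ring. Qed.

Lemma rc_curve_coef (r s : R -> R) (m n p : nat) :
  rc r s m n p / (INR (fact m) * INR (fact n)) =
  curve_coef r s (fun _ => 1) p (hpoly (m + n) (delta m)).
Proof. rewrite curve_coef_delta; unfold rc; f_equal; apply tcoef_ext; intros; ring. Qed.

Section ShiftedCurve.

Variables (r s : R -> R) (xs ys : R).
Hypotheses (Hr : smooth1_near r 0) (Hs : smooth1_near s 0) (r0 : r 0 = 0) (s0 : s 0 = 0).

Let R1 (t : R) := r t + xs.
Let S1 (t : R) := s t + ys.

Lemma shift_smooth : smooth1_near R1 0 /\ smooth1_near S1 0.
Proof using Hr Hs.
  split; apply smooth1_near_plus; auto using smooth1_near_const.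
Qed.

Lemma shift_origin : R1 0 = xs /\ S1 0 = ys.
Proof using r0 s0. unfold R1, S1; rewrite r0, s0; split; ring. Qed.

Lemma same_jet_taylor (K : nat) (v w : R -> R -> R) :
  smooth2_near v xs ys -> smooth2_near w 0 0 -> same_jet2 K v w xs ys 0 0 ->
  smooth1_near (fun t => v (R1 t) (S1 t)) 0 /\ smooth1_near (fun t => w (r t) (s t)) 0 /\
  same_jet K (fun t => v (R1 t) (S1 t)) (fun t => w (r t) (s t)).
Proof using All.
  intros Hv Hw J; destruct shift_smooth as [HR HS]; destruct shift_origin as [ER ES].
  split; [|split].
  - apply smooth1_near_comp; [rewrite ER, ES; exact Hv|exact HR|exact HS].
  - apply smooth1_near_comp; [rewrite r0, s0; exact Hw|exact Hr|exact Hs].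
  - apply same_jet_comp; try assumption.
    + rewrite ER, ES; exact Hv.
    + rewrite r0, s0; exact Hw.
    + rewrite ER, ES, r0, s0; exact J.
    + intros k _; unfold R1, S1; rewrite !Derive_shift; now split.
Qed.

Lemma tcoef_shifted (W : R -> R) (K p : nat) (w : R -> R -> R) :
  smooth1_near W 0 -> smooth2_near w xs ys -> (p <= K)%nat ->
  tcoef (fun t => w (R1 t) (S1 t) * W t) p = curve_coef r s W p (taylor K (jet2 w xs ys)).
Proof using All.
  intros HW Hw Hp; unfold curve_coef; apply (same_jet_tcoef K); [|exact Hp].
  destruct (same_jet_taylor K w _ Hw (smooth2_near_taylor K _ 0 0) (same_jet2_taylor K w xs ys Hw))
    as (A & B & J).
  apply same_jet_mult; auto using same_jet_refl.
Qed.

Lemma tcoef_shifted_conormal (K p : nat) (w : R -> R -> R) :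
  smooth2_near w xs ys -> (p <= K)%nat ->
  tcoef (fun t => dx w (R1 t) (S1 t) * Derive s t + dy w (R1 t) (S1 t) * (-1 * Derive r t)) p =
  conormal_coef r s p (taylor (S K) (jet2 w xs ys)).
Proof using All.
  intros Hw Hp; unfold conormal_coef.
  set (T := taylor (S K) (jet2 w xs ys)).
  rewrite (tcoef_ext (along_conormal r s T) (fun t =>
    dx T (r t) (s t) * Derive s t + dy T (r t) (s t) * (-1 * Derive r t)))
    by (intros; unfold along_conormal; ring).
  apply (same_jet_tcoef K); [|exact Hp].
  destruct (same_jet2_taylor (S K) w xs ys Hw) as (_ & Jx & Jy).
  assert (ST := smooth2_near_taylor (S K) (jet2 w xs ys) 0 0).
  destruct (same_jet_taylor K _ _ (smooth2_near_dx _ _ _ Hw) (smooth2_near_dx _ _ _ ST) Jx)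
    as (Ax & Bx & Cx).
  destruct (same_jet_taylor K _ _ (smooth2_near_dy _ _ _ Hw) (smooth2_near_dy _ _ _ ST) Jy)
    as (Ay & By & Cy).
  assert (Hs' := smooth1_near_Derive _ _ Hs).
  assert (Hr' := smooth1_near_mult _ _ _ (smooth1_near_const (-1) _) (smooth1_near_Derive _ _ Hr)).
  exact (same_jet_plus K _ _ _ _
    (smooth1_near_mult _ _ _ Ax Hs') (smooth1_near_mult _ _ _ Bx Hs')
    (smooth1_near_mult _ _ _ Ay Hr') (smooth1_near_mult _ _ _ By Hr')
    (same_jet_mult K _ _ _ _ Ax Bx Hs' Hs' Cx (same_jet_refl K _))
    (same_jet_mult K _ _ _ _ Ay By Hr' Hr' Cy (same_jet_refl K _))).
Qed.

End ShiftedCurve.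

(** * The coefficients only depend on the jet of the curve *)

Section JetDependence.

Variables (r s r2 s2 : R -> R) (M : nat).
Hypotheses (Hr : smooth1_near r 0) (Hs : smooth1_near s 0)
  (Hr2 : smooth1_near r2 0) (Hs2 : smooth1_near s2 0)
  (Jr : same_jet (M + 1) r2 r) (Js : same_jet (M + 1) s2 s).

Lemma same_jet_Derive_curves :
  same_jet M (Derive r2) (Derive r) /\ same_jet M (Derive s2) (Derive s).
Proof using Jr Js.
  replace (M + 1)%nat with (S M) in Jr, Js by lia; split; now apply same_jet_Derive.
Qed.

Lemma same_jet_curve (K : nat) (w : R -> R -> R) :
  (K <= M + 1)%nat -> (forall x y, smooth2_near w x y) ->
  same_jet K (fun t => w (r2 t) (s2 t)) (fun t => w (r t) (s t)).
Proof using All.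
  intros HK Hw; apply same_jet_comp; auto.
  - assert (Er : r2 0 = r 0) by (apply (Jr 0%nat); lia).
    assert (Es : s2 0 = s 0) by (apply (Js 0%nat); lia).
    rewrite Er, Es; apply same_jet2_refl.
  - intros k Hk; rewrite <- !Derive_n_S; split; [apply Jr|apply Js]; lia.
Qed.

Lemma curve_coef_same_jet (K p : nat) (W W2 : R -> R) (w : R -> R -> R) :
  (p <= K)%nat -> (K <= M + 1)%nat -> (forall x y, smooth2_near w x y) ->
  smooth1_near W 0 -> smooth1_near W2 0 -> same_jet K W2 W ->
  curve_coef r2 s2 W2 p w = curve_coef r s W p w.
Proof using All.
  intros Hp HK Hw HW HW2 J; apply (same_jet_tcoef K); [|exact Hp].
  apply same_jet_mult; auto using same_jet_curve; now apply smooth1_near_comp.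
Qed.

Lemma conormal_coef_same_jet (p : nat) (w : R -> R -> R) :
  (p <= M)%nat -> (forall x y, smooth2_near w x y) ->
  conormal_coef r2 s2 p w = conormal_coef r s p w.
Proof using All.
  intros Hp Hw; apply (same_jet_tcoef M); [|exact Hp].
  destruct same_jet_Derive_curves as [Dr Ds].
  assert (C := smooth1_near_const (-1) 0).
  assert (R2' := smooth1_near_mult _ _ _ C (smooth1_near_Derive _ _ Hr2)).
  assert (R1' := smooth1_near_mult _ _ _ C (smooth1_near_Derive _ _ Hr)).
  assert (S2' := smooth1_near_Derive _ _ Hs2); assert (S1' := smooth1_near_Derive _ _ Hs).
  assert (Wx := fun x y => smooth2_near_dx _ _ _ (Hw x y)).
  assert (Wy := fun x y => smooth2_near_dy _ _ _ (Hw x y)).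
  assert (X2 := smooth1_near_comp _ _ _ _ (Wx (r2 0) (s2 0)) Hr2 Hs2).
  assert (X1 := smooth1_near_comp _ _ _ _ (Wx (r 0) (s 0)) Hr Hs).
  assert (Y2 := smooth1_near_comp _ _ _ _ (Wy (r2 0) (s2 0)) Hr2 Hs2).
  assert (Y1 := smooth1_near_comp _ _ _ _ (Wy (r 0) (s 0)) Hr Hs).
  assert (Dr' := same_jet_mult M _ _ _ _ C C (smooth1_near_Derive _ _ Hr2)
    (smooth1_near_Derive _ _ Hr) (same_jet_refl M _) Dr).
  assert (E : forall a b, same_jet M
    (along_conormal a b w) (fun t => dx w (a t) (b t) * Derive b t + dy w (a t) (b t) * (-1 * Derive a t))).
  { intros a b; apply same_jet_ext_loc, filter_forall; intros t; unfold along_conormal; ring. }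
  eapply same_jet_trans; [apply E|]; eapply same_jet_trans; [|apply same_jet_sym, E].
  assert (HM : (M <= M + 1)%nat) by lia.
  exact (same_jet_plus M _ _ _ _
    (smooth1_near_mult _ _ _ X2 S2') (smooth1_near_mult _ _ _ X1 S1')
    (smooth1_near_mult _ _ _ Y2 R2') (smooth1_near_mult _ _ _ Y1 R1')
    (same_jet_mult M _ _ _ _ X2 X1 S2' S1' (same_jet_curve M _ HM Wx) Ds)
    (same_jet_mult M _ _ _ _ Y2 Y1 R2' R1' (same_jet_curve M _ HM Wy) Dr')).
Qed.

Lemma same_jet_speed :
  Derive r 0 ^ 2 + Derive s 0 ^ 2 > 0 ->
  Derive r2 0 ^ 2 + Derive s2 0 ^ 2 > 0 /\ same_jet M (speed r2 s2) (speed r s).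
Proof using All.
  intros P; destruct same_jet_Derive_curves as [Dr Ds].
  assert (P2 : Derive r2 0 ^ 2 + Derive s2 0 ^ 2 > 0).
  { assert (Er : Derive r2 0 = Derive r 0) by (apply (Dr 0%nat); lia).
    assert (Es : Derive s2 0 = Derive s 0) by (apply (Ds 0%nat); lia).
    now rewrite Er, Es. }
  split; [exact P2|].
  apply (same_jet_sqrt M (fun z => Derive r2 z ^ 2 + Derive s2 z ^ 2)
    (fun z => Derive r z ^ 2 + Derive s z ^ 2)); try (now apply smooth1_near_speed2); [exact P2|].
  assert (Hr' := smooth1_near_Derive _ _ Hr); assert (Hs' := smooth1_near_Derive _ _ Hs).
  assert (Hr2' := smooth1_near_Derive _ _ Hr2); assert (Hs2' := smooth1_near_Derive _ _ Hs2).
  assert (C := smooth1_near_const 1 0); simpl.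
  assert (Q : forall f g, smooth1_near f 0 -> smooth1_near g 0 -> same_jet M f g ->
    same_jet M (fun t => f t * (f t * 1)) (fun t => g t * (g t * 1))).
  { intros f g Hf Hg J.
    exact (same_jet_mult M f g _ _ Hf Hg (smooth1_near_mult _ _ _ Hf C) (smooth1_near_mult _ _ _ Hg C)
      J (same_jet_mult M f g _ _ Hf Hg C C J (same_jet_refl M _))). }
  assert (SQ : forall f, smooth1_near f 0 -> smooth1_near (fun t => f t * (f t * 1)) 0).
  { intros f Hf; exact (smooth1_near_mult _ _ _ Hf (smooth1_near_mult _ _ _ Hf C)). }
  exact (same_jet_plus M _ _ _ _ (SQ _ Hr2') (SQ _ Hr') (SQ _ Hs2') (SQ _ Hs')
    (Q _ _ Hr2' Hr' Dr) (Q _ _ Hs2' Hs' Ds)).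
Qed.

(** Conormal coefficients involve [r'] and [s'], hence are only compared up to
    order [M]. *)
Lemma same_coefs_same_jet :
  Derive r 0 ^ 2 + Derive s 0 ^ 2 > 0 -> same_coefs M r s r2 s2.
Proof using All.
  intros P; destruct (same_jet_speed P) as [P2 Jsp].
  assert (C := smooth1_near_const 1 0).
  assert (N : forall m n : nat, INR (fact m) * INR (fact n) <> 0).
  { intros; apply Rmult_integral_contrapositive_currified; apply INR_fact_neq_0. }
  assert (SP := smooth1_near_speed r s 0 Hr Hs P).
  assert (SP2 := smooth1_near_speed r2 s2 0 Hr2 Hs2 P2).
  assert (CC : forall d c p, (p <= M + 1)%nat ->
    curve_coef r s (fun _ => 1) p (hpoly d c) = curve_coef r2 s2 (fun _ => 1) p (hpoly d c)).
  { intros d c p Hp; symmetry; apply (curve_coef_same_jet (M + 1)); auto using same_jet_refl.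
    intros; apply smooth2_near_hpoly. }
  split; intros m n p Hp; (split; [|split]).
  - unfold gc; rewrite Gpoly_hpoly, <- !(curve_coef_1 _ _ _ (hpoly _ _)); now apply CC.
  - unfold hc; rewrite Hpoly_hpoly, <- !(curve_coef_1 _ _ _ (hpoly _ _)); now apply CC.
  - apply (Rmult_eq_reg_r (/ (INR (fact m) * INR (fact n)))); [|now apply Rinv_neq_0_compat].
    change (rc r s m n p / (INR (fact m) * INR (fact n)) = rc r2 s2 m n p / (INR (fact m) * INR (fact n))).
    rewrite !rc_curve_coef; now apply CC.
  - unfold gtc; rewrite Gpoly_hpoly; symmetry; apply conormal_coef_same_jet; [exact Hp|].
    intros; apply smooth2_near_hpoly.
  - unfold htc; rewrite Hpoly_hpoly; symmetry; apply conormal_coef_same_jet; [exact Hp|].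
    intros; apply smooth2_near_hpoly.
  - apply (Rmult_eq_reg_r (/ (INR (fact m) * INR (fact n)))); [|now apply Rinv_neq_0_compat].
    transitivity (curve_coef r s (speed r s) p (hpoly (m + n) (delta m)));
      [rewrite curve_coef_delta; reflexivity|].
    transitivity (curve_coef r2 s2 (speed r2 s2) p (hpoly (m + n) (delta m)));
      [|rewrite curve_coef_delta; reflexivity].
    symmetry; apply (curve_coef_same_jet M); auto; [lia|intros; apply smooth2_near_hpoly].
Qed.

End JetDependence.

(** Both families satisfy the same recursion. *)
Lemma transmission_same_coefs (r s r2 s2 : R -> R) (M : nat) (sigma : R) :
  same_coefs M r s r2 s2 ->
  forall m n, in_Lambda1 (M + 1) m n ->
    formal_jump r2 s2 M sigma m n = formal_jump r s M sigma m n.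
Proof.
  intros C m n H; symmetry; revert m n H; unfold formal_jump.
  eapply (recursion_unique r2 s2); [|apply rec_solution_correct].
  apply (recursion_same_coefs r s); [exact C|apply rec_solution_correct].
Qed.

(** * The triangular system *)

Lemma sum_n_truncate (a : nat -> R) (q N : nat) :
  (q <= N)%nat -> (forall k, (q < k)%nat -> a k = 0) -> sum_n a N = sum_n a q.
Proof.
  intros H Z; induction N as [|N IH]; [now replace q with 0%nat by lia|].
  destruct (Nat.eq_dec q (S N)) as [->|]; [easy|].
  rewrite sum_Sn, IH, Z by lia; exact (Rplus_0_r _).
Qed.

Section System.

Variables (M : nat) (r s : R -> R) (sigma xs ys : R).
Hypotheses (HM : (1 <= M)%nat) (Hr : smooth1_near r 0) (Hs : smooth1_near s 0)
  (r0 : r 0 = 0) (s0 : s 0 = 0) (regular : Derive r 0 ^ 2 + Derive s 0 ^ 2 > 0).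
Variables (v g1 g : R -> R -> R) (fp fm : nat -> nat -> R).
Hypotheses (Hv : smooth2_near v xs ys) (Hg1 : smooth2_near g1 xs ys) (Hg : smooth2_near g xs ys)
  (pde : forall m n, jet2 v xs ys (S (S m)) n + jet2 v xs ys m (S (S n)) = fm m n - fp m n)
  (jump0 : locally 0 (fun t => v (r t + xs) (s t + ys) = g1 (r t + xs) (s t + ys)))
  (jump1 : locally 0 (fun t =>
    dx v (r t + xs) (s t + ys) * Derive s t + dy v (r t + xs) (s t + ys) * (-1 * Derive r t) =
    sigma * (g (r t + xs) (s t + ys) * speed r s t))).

(** Comparison of Taylor coefficients in [v = g1] along the curve. *)
Lemma value_system (p : nat) :
  (p <= M + 1)%nat ->
  jet2 v xs ys 0 0 * gc r s 0 0 p
  + sum_n (fun d => jet2 v xs ys 0 (S d) * gc r s 0 (S d) p + jet2 v xs ys 1 d * gc r s 1 d p) M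
  = rhsF r s (V := R_ModuleSpace) M fp fm (jet2 g1 xs ys) p.
Proof using HM Hr Hs r0 s0 Hv Hg1 pde jump0.
  intros Hp; assert (C := smooth1_near_const 1 0).
  assert (E1 := tcoef_shifted r s xs ys Hr Hs r0 s0 (fun _ => 1) (M + 1) p v C Hv Hp).
  assert (E2 := tcoef_shifted r s xs ys Hr Hs r0 s0 (fun _ => 1) (M + 1) p g1 C Hg1 Hp).
  assert (L := linear_curve_coef r s Hr Hs (fun _ => 1) p C).
  rewrite (linear_functional_elimination _ (jet2 v xs ys) (fun m n => fm m n - fp m n) M HM L pde) in E1.
  rewrite (linear_functional_monomials _ (M + 1) (jet2 g1 xs ys) L) in E2.
  assert (E : tcoef (fun t => v (r t + xs) (s t + ys) * 1) p =
              tcoef (fun t => g1 (r t + xs) (s t + ys) * 1) p).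
  { apply tcoef_ext_loc; revert jump0; apply filter_imp; intros t ->; reflexivity. }
  rewrite E1, E2 in E; clear E1 E2.
  assert (G : forall m n, curve_coef r s (fun _ => 1) p (Gpoly m n) = gc r s m n p)
    by (intros; apply curve_coef_1).
  assert (H : forall m n, curve_coef r s (fun _ => 1) p (Hpoly m n) = hc r s m n p)
    by (intros; apply curve_coef_1).
  rewrite G in E.
  rewrite (sum_n_ext _ (fun d => jet2 v xs ys 0 (S d) * gc r s 0 (S d) p
    + jet2 v xs ys 1 d * gc r s 1 d p)) in E by (intros; now rewrite !G).
  unfold rhsF.
  rewrite (sum_Lambda_ext (M - 1) _ (fun m n => scal (hc r s m n p) (minus (fm m n) (fp m n)))) in E
    by (intros; rewrite H; apply Rmult_comm).
  rewrite (sum_Lambda_ext (M + 1) (fun m n => curve_coef _ _ _ _ _ * _)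
    (fun m n => scal (rc r s m n p / (INR (fact m) * INR (fact n))) (jet2 g1 xs ys m n))) in E
    by (intros; rewrite <- rc_curve_coef; reflexivity).
  assert (K : forall a b c, a - b = c -> a = b + c) by (intros; lra); exact (K _ _ _ E).
Qed.

(** Comparison of Taylor coefficients in the identity for the conormal derivative;
    the constant term [Gpoly 0 0] has no conormal derivative. *)
Lemma normal_system (p : nat) :
  (p <= M)%nat ->
  sum_n (fun d => jet2 v xs ys 0 (S d) * gtc r s 0 (S d) p + jet2 v xs ys 1 d * gtc r s 1 d p) M
  = rhsG r s (V := R_ModuleSpace) M sigma fp fm (jet2 g xs ys) p.
Proof using HM Hr Hs r0 s0 regular Hv Hg pde jump1.
  intros Hp; assert (C := smooth1_near_speed r s 0 Hr Hs regular).
  assert (E1 := tcoef_shifted_conormal r s xs ys Hr Hs r0 s0 M p v Hv Hp).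
  assert (E2 := tcoef_shifted r s xs ys Hr Hs r0 s0 (speed r s) M p g C Hg Hp).
  replace (S M) with (M + 1)%nat in E1 by lia.
  rewrite (linear_functional_elimination _ (jet2 v xs ys) (fun m n => fm m n - fp m n) M HM
    (linear_conormal_coef r s Hr Hs p) pde) in E1.
  rewrite (linear_functional_monomials _ M (jet2 g xs ys)
    (linear_curve_coef r s Hr Hs (speed r s) p C)) in E2.
  assert (E : tcoef (fun t => dx v (r t + xs) (s t + ys) * Derive s t
      + dy v (r t + xs) (s t + ys) * (-1 * Derive r t)) p =
    tcoef (fun t => sigma * (g (r t + xs) (s t + ys) * speed r s t)) p)
    by exact (tcoef_ext_loc _ _ p jump1).
  rewrite tcoef_scal, E1, E2 in E; clear E1 E2.
  assert (G : forall m n, conormal_coef r s p (Gpoly m n) = gtc r s m n p) by reflexivity.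
  assert (H : forall m n, conormal_coef r s p (Hpoly m n) = htc r s m n p) by reflexivity.
  rewrite G, gtc_00 in E.
  unfold rhsG.
  rewrite (sum_Lambda_ext (M - 1) _ (fun m n => scal (htc r s m n p) (minus (fm m n) (fp m n)))) in E
    by (intros; rewrite H; apply Rmult_comm).
  rewrite (sum_Lambda_ext M (fun m n => curve_coef _ _ _ _ _ * _)
    (fun m n => scal (rtc r s m n p / (INR (fact m) * INR (fact n))) (jet2 g xs ys m n))) in E
    by (intros; rewrite curve_coef_delta; reflexivity).
  assert (K : forall z a b c, z * 0 + a - b = c -> a = b + c) by (intros; lra); exact (K _ _ _ _ E).
Qed.

(** The terms of degree greater than [p] vanish to order [p], so the sums stop at
    [p]. *)
Lemma jets_satisfy_recursion :
  satisfies_recursion r s (V := R_ModuleSpace) M sigma fp fm (jet2 g1 xs ys) (jet2 g xs ys)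
    (jet2 v xs ys).
Proof using All.
  apply recursion_of_system.
  - assert (E := locally_singleton _ _ jump0); cbv beta in E.
    rewrite r0, s0, !Rplus_0_l in E; exact E.
  - intros p Hp; split; [|split].
    + apply Qdet_neq_0; auto; apply Hp.
    + rewrite <- value_system by apply Hp.
      rewrite gc_00; destruct (Nat.eqb_spec p 0); [lia|]; rewrite Rmult_0_r, Rplus_0_l.
      symmetry; apply sum_n_truncate; [lia|]; intros k Hk.
      rewrite !gc_low by (auto; lia); ring.
    + rewrite <- normal_system by lia.
      symmetry; apply sum_n_truncate; [lia|]; intros k Hk.
      rewrite !gtc_low by (auto; lia); ring.
Qed.

End System.

(** * Transmission of the jets across the interface *)

(** The conormal [(s', -r')] is [sigma] times the speed times the unit normal. *)
Lemma normal_jump_along_curve (sigma a b n1 n2 vx vy g r' s' : R) :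
  (sigma = 1 /\ a = n1 /\ b = n2 \/ sigma = - 1 /\ a = - n1 /\ b = - n2) ->
  r' ^ 2 + s' ^ 2 > 0 ->
  a = s' / sqrt (r' ^ 2 + s' ^ 2) -> b = - r' / sqrt (r' ^ 2 + s' ^ 2) ->
  vx * n1 + vy * n2 = g ->
  vx * s' + vy * (-1 * r') = sigma * (g * sqrt (r' ^ 2 + s' ^ 2)).
Proof.
  intros O P Ea Eb <-; assert (S := sqrt_lt_R0 _ P); set (q := sqrt (r' ^ 2 + s' ^ 2)) in *.
  assert (A : s' = a * q) by (rewrite Ea; field; lra).
  assert (B : -1 * r' = b * q) by (rewrite Eb; field; lra).
  rewrite A, B; destruct O as [(-> & -> & ->)|(-> & -> & ->)]; ring.
Qed.

Theorem theorem2p3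
  (M : nat) (hM : (1 <= M)%nat)
  (l1 l2 l3 l4 : R) (hl12 : l1 < l2) (hl34 : l3 < l4)
  (psi nx ny : R -> R -> R)
  (hpsi : forall x y, rect l1 l2 l3 l4 x y -> smooth2_at psi x y)
  (hcurve : smooth_curve (rect l1 l2 l3 l4) psi)
  (hnormal : unit_normal (rect l1 l2 l3 l4) psi nx ny)
  (u f g0 g1 g : R -> R -> R)
  (hg0 : smooth_on_sides l1 l2 l3 l4 g0)
  (hu : interface_solution l1 l2 l3 l4 psi nx ny f g0 g1 g u)
  (xs ys : R) (hxy : Gamma (rect l1 l2 l3 l4) psi xs ys)
  (r s : R -> R) (eps : R)
  (hrs : local_param (rect l1 l2 l3 l4) psi xs ys r s eps)
  (hg1 : smooth2_near g1 xs ys) (hg : smooth2_near g xs ys)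
  (up um fp fm : R -> R -> R)
  (hup : smooth_extension (Omega_plus (rect l1 l2 l3 l4) psi) u up xs ys)
  (hum : smooth_extension (Omega_minus (rect l1 l2 l3 l4) psi) u um xs ys)
  (hfp : smooth_extension (Omega_plus (rect l1 l2 l3 l4) psi) f fp xs ys)
  (hfm : smooth_extension (Omega_minus (rect l1 l2 l3 l4) psi) f fm xs ys)
  (sigma : R) (hsigma : orientation_sign nx ny xs ys r s sigma) :
  (* transmission identity *)
  (forall m' n', in_Lambda1 (M + 1) m' n' ->
     jet2 um xs ys m' n' =
       jet2 up xs ys m' n'
       + sum_Lambda (M - 1) (fun m n =>
           T_plus r s M sigma m' n' m n * jet2 fp xs ys m n
           + T_minus r s M sigma m' n' m n * jet2 fm xs ys m n)
       + sum_Lambda (M + 1) (fun m n =>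
           T_g1 r s M sigma m' n' m n * jet2 g1 xs ys m n)
       + sum_Lambda M (fun m n =>
           T_g r s M sigma m' n' m n * jet2 g xs ys m n))
  /\
  (* the coefficients depend only on sigma and the derivatives of r, s at 0 of
     order at most M + 1 *)
  (forall r2 s2 : R -> R,
     locally 0 (fun t => smooth1_at r2 t /\ smooth1_at s2 t) ->
     (forall k, (k <= M + 1)%nat ->
        Derive_n r2 k 0 = Derive_n r k 0 /\ Derive_n s2 k 0 = Derive_n s k 0) ->
     forall m' n', in_Lambda1 (M + 1) m' n' ->
       (forall m n, in_Lambda (M - 1) m n ->
          T_plus r2 s2 M sigma m' n' m n = T_plus r s M sigma m' n' m n /\
          T_minus r2 s2 M sigma m' n' m n = T_minus r s M sigma m' n' m n) /\
       (forall m n, in_Lambda (M + 1) m n ->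
          T_g1 r2 s2 M sigma m' n' m n = T_g1 r s M sigma m' n' m n) /\
       (forall m n, in_Lambda M m n ->
          T_g r2 s2 M sigma m' n' m n = T_g r s M sigma m' n' m n))
  /\
  (* the matrices Q_p are well defined and the actual jumps satisfy the recursion *)
  (forall p, (1 <= p <= M + 1)%nat -> Qdet r s p <> 0)
  /\
  satisfies_recursion r s (V := R_ModuleSpace) M sigma
    (jet2 fp xs ys) (jet2 fm xs ys) (jet2 g1 xs ys) (jet2 g xs ys)
    (fun m n => jet2 up xs ys m n - jet2 um xs ys m n).
Proof.
  destruct hrs as (Heps & r0 & s0 & Hcurve & _).
  assert (Leps : locally 0 (fun t => Rabs t < eps)).
  { exists (mkposreal eps Heps); simpl; intros t Ht; unfold ball in Ht; simpl in Ht.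
    unfold AbsRing_ball, abs, minus, plus, opp in Ht; simpl in Ht.
    now replace (t + - 0) with t in Ht by ring. }
  assert (Hr : smooth1_near r 0).
  { refine (filter_imp _ _ _ Leps); intros t Ht; apply (Hcurve t Ht). }
  assert (Hs : smooth1_near s 0).
  { refine (filter_imp _ _ _ Leps); intros t Ht; apply (Hcurve t Ht). }
  assert (regular : Derive r 0 ^ 2 + Derive s 0 ^ 2 > 0).
  { apply (Hcurve 0); now rewrite Rabs_R0. }
  destruct hu as (Hpoisson & _ & Hjump & Hnjump).
  assert (OO := rect_open l1 l2 l3 l4).
  assert (Oplus := Omega_plus_open _ _ OO hpsi).
  assert (Ominus := Omega_minus_open _ _ OO hpsi).
  destruct (Gamma_adherent _ _ _ _ hnormal xs ys hxy) as [Aplus Aminus].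
  assert (Pplus : forall x y, Omega_plus (rect l1 l2 l3 l4) psi x y -> poisson_at u f x y).
  { intros x y [H1 H2]; apply Hpoisson; [exact H1|intros [_ H]; lra]. }
  assert (Pminus : forall x y, Omega_minus (rect l1 l2 l3 l4) psi x y -> poisson_at u f x y).
  { intros x y [H1 H2]; apply Hpoisson; [exact H1|intros [_ H]; lra]. }
  assert (Su := proj1 hup); assert (Sm := proj1 hum).
  set (v := fun x y => up x y + -1 * um x y).
  assert (Sv : smooth2_near v xs ys) by exact (smooth2_near_axpy up um (-1) xs ys Su Sm).
  assert (Jv : forall m n, jet2 v xs ys m n = jet2 up xs ys m n - jet2 um xs ys m n).
  { intros m n; unfold jet2, v; rewrite partial_derive_axpy by assumption; ring. }
  assert (pde : forall m n, jet2 v xs ys (S (S m)) n + jet2 v xs ys m (S (S n)) =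
    jet2 fm xs ys m n - jet2 fp xs ys m n).
  { intros m n; rewrite !Jv.
    assert (E1 := extension_poisson_jet _ _ _ _ _ _ _ Oplus Aplus Pplus hup hfp m n).
    assert (E2 := extension_poisson_jet _ _ _ _ _ _ _ Ominus Aminus Pminus hum hfm m n); lra. }
  assert (LJ : locally_2d (fun x y => Gamma (rect l1 l2 l3 l4) psi x y ->
    v x y = g1 x y /\ dx v x y * nx x y + dy v x y * ny x y = g x y) xs ys).
  { generalize (locally_2d_and _ _ _ _
      (interface_jumps _ _ _ _ OO hpsi hnormal g1 g u up um xs ys Hjump Hnjump hup hum)
      (locally_2d_and _ _ _ _ (smooth2_near_open _ _ _ Su) (smooth2_near_open _ _ _ Sm))).
    apply locally_2d_impl, locally_2d_forall; intros x y (J & Su' & Sm') G.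
    unfold v at 2 3; rewrite dx_axpy, dy_axpy by assumption; exact (J G). }
  assert (LC : locally 0 (fun t =>
    v (r t + xs) (s t + ys) = g1 (r t + xs) (s t + ys) /\
    dx v (r t + xs) (s t + ys) * nx (r t + xs) (s t + ys)
    + dy v (r t + xs) (s t + ys) * ny (r t + xs) (s t + ys) = g (r t + xs) (s t + ys) /\
    Derive r t ^ 2 + Derive s t ^ 2 > 0)).
  { destruct (shift_smooth r s xs ys Hr Hs) as [HR HS].
    replace xs with (r 0 + xs) in LJ by (rewrite r0; ring).
    replace ys with (s 0 + ys) in LJ by (rewrite s0; ring).
    generalize (filter_and _ _ (locally_2d_comp _ (fun t => r t + xs) (fun t => s t + ys) 0
      (smooth1_near_continuous _ _ HR) (smooth1_near_continuous _ _ HS) LJ) Leps).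
    apply filter_imp; intros t [J Ht]; destruct (Hcurve t Ht) as (_ & _ & P & G).
    destruct (J G); auto. }
  assert (Rec : satisfies_recursion r s (V := R_ModuleSpace) M sigma
    (jet2 fp xs ys) (jet2 fm xs ys) (jet2 g1 xs ys) (jet2 g xs ys)
    (fun m n => jet2 up xs ys m n - jet2 um xs ys m n)).
  { replace (fun m n => jet2 up xs ys m n - jet2 um xs ys m n) with (jet2 v xs ys).
    2: { apply functional_extensionality; intros m; apply functional_extensionality; intros n; apply Jv. }
    apply jets_satisfy_recursion; auto.
    - revert LC; apply filter_imp; intros t H; apply H.
    - assert (LO : locally 0 (fun t =>
        let q := sqrt (Derive r t ^ 2 + Derive s t ^ 2) in
        sigma = 1 /\ Derive s t / q = nx (r t + xs) (s t + ys) /\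
          - Derive r t / q = ny (r t + xs) (s t + ys) \/
        sigma = - 1 /\ Derive s t / q = - nx (r t + xs) (s t + ys) /\
          - Derive r t / q = - ny (r t + xs) (s t + ys))).
      { destruct hsigma as [[E H]|[E H]]; revert H; apply filter_imp; intros t H; [left|right]; auto. }
      generalize (filter_and _ _ LC LO); apply filter_imp; intros t [(_ & J & P) O].
      eapply normal_jump_along_curve; [exact O|exact P|reflexivity|reflexivity|exact J]. }
  split; [|split; [|split]].
  - intros m' n' H.
    assert (E := recursion_evaluate M _ _ _ _ r s sigma _ Rec m' n' H).
    rewrite evaluate_transmission in E; cbv beta in E; lra.
  - intros r2 s2 H2 HD m' n' H.
    assert (Hr2 : smooth1_near r2 0) by (refine (filter_imp _ _ _ H2); now intros t []).
    assert (Hs2 : smooth1_near s2 0) by (refine (filter_imp _ _ _ H2); now intros t []).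
    assert (E : formal_jump r2 s2 M sigma m' n' = formal_jump r s M sigma m' n').
    { apply transmission_same_coefs; [|exact H].
      apply same_coefs_same_jet; auto; intros k Hk; now apply HD. }
    unfold T_plus, T_minus, T_g1, T_g; rewrite E; repeat split.
  - intros p Hp; apply Qdet_neq_0; auto; apply Hp.
  - exact Rec.
Qed.
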